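(* $\mathsf{CNOT}$ is a discrete inverse category.
   Context: $\mathsf{CNOT}$ is the strict symmetric monoidal category whose objects are the natural numbers $n$, with $n\otimes m=n+m$, generated by $\mathsf{cnot}:2\to 2$, $|1\rangle:0\to 1$, $\langle 1|:1\to 0$ (and the symmetry $\sigma:2\to2$), subject exactly to the identities below. Composition is diagrammatic ($fg$ = first $f$ then $g$). On $k$ wires numbered $1..k$ top to bottom, $C_{i\to j}$ is the $\mathsf{cnot}$ gate with control wire $i$ and target wire $j$ ($\mathsf{cnot}$ has control on its first wire). Identities: (CNT.1) $C_{1\to2}C_{2\to1}C_{1\to2}=\sigma$; (CNT.2) $C_{1\to2}C_{1\to2}=1_2$; (CNT.3) $C_{2\to1}C_{2\to3}=C_{2\to3}C_{2\to1}$; (CNT.4) $(|1\rangle\otimes1_1)C_{1\to2}=(|1\rangle\otimes1_1)C_{1\to2}(\langle1|\otimes1_1)(|1\rangle\otimes1_1)$ and $C_{1\to2}(\langle1|\otimes1_1)=(\langle1|\otimes1_1)(|1\rangle\otimes1_1)C_{1\to2}(\langle1|\otimes1_1)$; (CNT.5) $C_{1\to2}C_{3\to2}=C_{3\to2}C_{1\to2}$; (CNT.6) $|1\rangle\langle1|=1_0$; (CNT.7) $(|1\rangle\otimes|1\rangle\otimes1_1)C_{1\to2}C_{2\to3}(\langle1|\otimes1_2)=(|1\rangle\otimes|1\rangle\otimes1_1)C_{1\to2}(\langle1|\otimes1_2)$ and $(|1\rangle\otimes1_2)C_{2\to3}C_{1\to2}(\langle1|\otimes\langle1|\otimes1_1)=(|1\rangle\otimes1_2)C_{1\to2}(\langle1|\otimes\langle1|\otimes1_1)$;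 (CNT.8) $C_{1\to2}C_{2\to3}C_{1\to2}=C_{2\to3}C_{1\to3}$; (CNT.9) $(|1\rangle\otimes|1\rangle\otimes1_1)C_{1\to2}(\langle1|\otimes\langle1|\otimes1_1)=(|1\rangle\otimes|1\rangle\otimes\langle1|)C_{1\to2}(\langle1|\otimes\langle1|\otimes|1\rangle)$. A restriction category is a category with an assignment $f\mapsto\overline f:A\to A$ for each $f:A\to B$ such that $\overline f f=f$, $\overline f\,\overline g=\overline g\,\overline f$ and $\overline{\overline g f}=\overline f\,\overline g$ when $\mathrm{dom} f=\mathrm{dom} g$, and $f\overline g=\overline{fg}f$ when $\mathrm{cod}f=\mathrm{dom}g$. A map is total if $\overline f=1$. An inverse category is a restriction category in which every map $f$ is a partial isomorphism (there is $g$ with $fg=\overline f$, $gf=\overline g$); equivalently, a category with an identity-on-objects involution $(-)^\circ:\mathbb{X}^{op}\to\mathbb{X}$ with $(c^\circ)^\circ=c$, $cc^\circ c=c$, $cc^\circ dd^\circ=dd^\circ cc^\circ$, with $\overline c=cc^\circ$. An inverse category with a (symmetric) tensor product $\otimes$ preserving $(-)^\circ$ has inverse products if there is a total natural transformation $\Delta_A:A\to A\otimes A$ which is cocommutative ($\Delta_A c_{A,A}=\Delta_A$), coassociative ($\Delta_A(1\otimes\Delta_A)=\Delta_A(\Delta_A\otimes1)a_{A,A,A}$), such that $(\Delta_A,\Delta_A^\circ)$ is semi-Frobenius ($(\Delta_A\otimes1)a_{A,A,A}(1\otimes\Delta_A^\circ)=\Delta_A^\circ\Delta_A=(1\otimes\Delta_A)a^\circ_{A,A,A}(\Delta_A^\circ\otimes1)$),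 and uniform copying holds ($\Delta_{A\otimes B}=(\Delta_A\otimes\Delta_B)\mathsf{ex}_{A,B}$, where $\mathsf{ex}:(A\otimes A)\otimes(B\otimes B)\to(A\otimes B)\otimes(A\otimes B)$ is the canonical exchange isomorphism built from associators and symmetry). A discrete inverse category is an inverse category with inverse products. *)

(* Defs.v *)
From Stdlib Require Import Setoid Morphisms Arith Eqdep_dec.

Set Implicit Arguments.
Unset Strict Implicit.
Unset Printing Implicit Defensive.

Declare Scope cat_scope.
Open Scope cat_scope.

Reserved Notation "f ≈ g" (at level 70, no associativity).
Reserved Notation "f ;; g" (at level 40, left associativity).
Reserved Notation "A [x] B" (at level 39, left associativity).
Reserved Notation "f [*] g" (at level 39, left associativity).

(** * Categories

  Equality of parallel maps is an equivalence relation [heq], so that a category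
  presented by generators and relations needs no explicit quotient; every
  operation on maps is required to respect it.  Composition is diagrammatic:
  [f ;; g] is first [f], then [g]. *)

Record Category := {
  Ob :> Type;
  Hom : Ob -> Ob -> Type;
  heq : forall A B, Hom A B -> Hom A B -> Prop;
  idm : forall A, Hom A A;
  comp : forall A B D, Hom A B -> Hom B D -> Hom A D;
  heq_equiv : forall A B, Equivalence (@heq A B);
  comp_proper : forall A B D,
    Proper (@heq A B ==> @heq B D ==> @heq A D) (@comp A B D);
  comp_idl : forall A B (f : Hom A B), heq (comp (idm A) f) f;
  comp_idr : forall A B (f : Hom A B), heq (comp f (idm B)) f;
  comp_assoc : forall A B D E (f : Hom A B) (g : Hom B D) (h : Hom D E),
    heq (comp (comp f g) h) (comp f (comp g h))
}.

Arguments Hom {c} _ _.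
Arguments heq {c A B} _ _.
Arguments idm {c} A.
Arguments comp {c A B D} _ _.

Notation "f ≈ g" := (heq f g) : cat_scope.
Notation "f ;; g" := (comp f g) : cat_scope.

#[export] Existing Instance heq_equiv.
#[export] Existing Instance comp_proper.

(** * Symmetric monoidal categories *)

Record SymMonCat := {
  smc_cat :> Category;
  unit_ob : smc_cat;
  tens : smc_cat -> smc_cat -> smc_cat;
  tensm : forall A B A' B' : smc_cat,
    Hom A A' -> Hom B B' -> Hom (tens A B) (tens A' B');
  assoc : forall A B D, Hom (tens (tens A B) D) (tens A (tens B D));
  associ : forall A B D, Hom (tens A (tens B D)) (tens (tens A B) D);
  lunit : forall A, Hom (tens unit_ob A) A;
  luniti : forall A, Hom A (tens unit_ob A);
  runit : forall A, Hom (tens A unit_ob) A;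
  runiti : forall A, Hom A (tens A unit_ob);
  sym : forall A B, Hom (tens A B) (tens B A);

  tensm_proper : forall A B A' B',
    Proper (@heq _ A A' ==> @heq _ B B' ==> @heq _ (tens A B) (tens A' B'))
      (@tensm A B A' B');
  tensm_id : forall A B, tensm (idm A) (idm B) ≈ idm (tens A B);
  tensm_comp : forall A B A' B' A'' B''
      (f : Hom A A') (f' : Hom A' A'') (g : Hom B B') (g' : Hom B' B''),
    tensm (f ;; f') (g ;; g') ≈ tensm f g ;; tensm f' g';

  assoc_nat : forall A B D A' B' D' (f : Hom A A') (g : Hom B B') (h : Hom D D'),
    tensm (tensm f g) h ;; assoc A' B' D' ≈ assoc A B D ;; tensm f (tensm g h);
  lunit_nat : forall A B (f : Hom A B),
    tensm (idm unit_ob) f ;; lunit B ≈ lunit A ;; f;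
  runit_nat : forall A B (f : Hom A B),
    tensm f (idm unit_ob) ;; runit B ≈ runit A ;; f;
  sym_nat : forall A B A' B' (f : Hom A A') (g : Hom B B'),
    tensm f g ;; sym A' B' ≈ sym A B ;; tensm g f;

  assocK : forall A B D, assoc A B D ;; associ A B D ≈ idm _;
  associK : forall A B D, associ A B D ;; assoc A B D ≈ idm _;
  lunitK : forall A, lunit A ;; luniti A ≈ idm _;
  lunitiK : forall A, luniti A ;; lunit A ≈ idm _;
  runitK : forall A, runit A ;; runiti A ≈ idm _;
  runitiK : forall A, runiti A ;; runit A ≈ idm _;
  symK : forall A B, sym A B ;; sym B A ≈ idm _;

  pentagon : forall A B D E,
    assoc (tens A B) D E ;; assoc A B (tens D E)
    ≈ tensm (assoc A B D) (idm E) ;; assoc A (tens B D) E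
         ;; tensm (idm A) (assoc B D E);
  triangle : forall A B,
    assoc A unit_ob B ;; tensm (idm A) (lunit B) ≈ tensm (runit A) (idm B);
  hexagon : forall A B D,
    assoc A B D ;; sym A (tens B D) ;; assoc B D A
    ≈ tensm (sym A B) (idm D) ;; assoc B A D ;; tensm (idm B) (sym A D)
}.

Arguments unit_ob {s}.
Arguments tens {s} _ _.
Arguments tensm {s A B A' B'} _ _.
Arguments assoc {s} A B D.
Arguments associ {s} A B D.
Arguments lunit {s} A.
Arguments luniti {s} A.
Arguments runit {s} A.
Arguments runiti {s} A.
Arguments sym {s} A B.

Notation "A [x] B" := (tens A B) : cat_scope.
Notation "f [*] g" := (tensm f g) : cat_scope.

#[export] Existing Instance tensm_proper.

(** [(A A)(B B) -> A(A(B B)) -> A((A B)B) -> A((B A)B) -> A(B(A B)) -> (A B)(A B)] *)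
Definition exch (M : SymMonCat) (A B : M) :
    Hom ((A [x] A) [x] (B [x] B)) ((A [x] B) [x] (A [x] B)) :=
  assoc A A (B [x] B)
  ;; (idm A [*] associ A B B)
  ;; (idm A [*] (sym A B [*] idm B))
  ;; (idm A [*] assoc B A B)
  ;; associ A B (A [x] B).

(** * Restriction categories and inverse categories *)

Record RestrictionStructure (C : Category) := {
  restr : forall A B : C, Hom A B -> Hom A A;
  restr_proper : forall A B, Proper (heq ==> heq) (@restr A B);
  restr_self : forall A B (f : Hom A B), restr f ;; f ≈ f;
  restr_comm : forall A B D (f : Hom A B) (g : Hom A D),
    restr f ;; restr g ≈ restr g ;; restr f;
  restr_restr : forall A B D (f : Hom A B) (g : Hom A D),
    restr (restr g ;; f) ≈ restr f ;; restr g;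
  restr_comp : forall A B D (f : Hom A B) (g : Hom B D),
    f ;; restr g ≈ restr (f ;; g) ;; f
}.

#[export] Existing Instance restr_proper.

Definition total (C : Category) (R : RestrictionStructure C) (A B : C)
    (f : Hom A B) : Prop :=
  restr R f ≈ idm A.

Definition is_partial_inverse (C : Category) (R : RestrictionStructure C)
    (A B : C) (f : Hom A B) (g : Hom B A) : Prop :=
  f ;; g ≈ restr R f /\ g ;; f ≈ restr R g.

Lemma partial_inverse_unique (C : Category) (R : RestrictionStructure C)
    (A B : C) (f : Hom A B) (g g' : Hom B A) :
  is_partial_inverse R f g -> is_partial_inverse R f g' -> g ≈ g'.
Proof.
  intros [fg gf] [fg' gf'].
  transitivity (restr R g' ;; g).
  - assert (E : restr R g ;; restr R g' ;; g ≈ g).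
    { rewrite <- gf, <- gf'.
      rewrite (comp_assoc g f), <- (comp_assoc f g' f), fg', restr_self, gf.
      apply restr_self. }
    rewrite <- E at 1.
    rewrite restr_comm, comp_assoc, restr_self. reflexivity.
  - rewrite <- gf', comp_assoc, fg, <- fg', <- comp_assoc, gf'.
    apply restr_self.
Qed.

(** A restriction category in which every map is a partial isomorphism.  The
  partial inverse [f°] is recorded as a function; by [partial_inverse_unique]
  it is determined by the restriction structure. *)
Record InverseStructure (C : Category) := {
  inv_restr :> RestrictionStructure C;
  pinv : forall A B : C, Hom A B -> Hom B A;
  pinv_proper : forall A B, Proper (heq ==> heq) (@pinv A B);
  pinvP : forall A B (f : Hom A B), is_partial_inverse inv_restr f (pinv f)
}.

#[export] Existing Instance pinv_proper.

Definition tensor_preserves_pinv (M : SymMonCat) (I : InverseStructure M) : Prop :=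
  forall (A B A' B' : M) (f : Hom A A') (g : Hom B B'),
    pinv I (f [*] g) ≈ pinv I f [*] pinv I g.

(** * Inverse products *)

Record is_inverse_product (M : SymMonCat) (I : InverseStructure M)
    (Delta : forall A : M, Hom A (A [x] A)) : Prop := {
  Delta_total : forall A, total I (Delta A);
  Delta_nat : forall A B (f : Hom A B), f ;; Delta B ≈ Delta A ;; (f [*] f);
  Delta_cocomm : forall A, Delta A ;; sym A A ≈ Delta A;
  Delta_coassoc : forall A,
    Delta A ;; (idm A [*] Delta A) ≈ Delta A ;; (Delta A [*] idm A) ;; assoc A A A;
  Delta_frob_l : forall A,
    (Delta A [*] idm A) ;; assoc A A A ;; (idm A [*] pinv I (Delta A))
    ≈ pinv I (Delta A) ;; Delta A;
  Delta_frob_r : forall A,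
    pinv I (Delta A) ;; Delta A
    ≈ (idm A [*] Delta A) ;; pinv I (assoc A A A) ;; (pinv I (Delta A) [*] idm A);
  Delta_uniform : forall A B, Delta (A [x] B) ≈ (Delta A [*] Delta B) ;; exch A B
}.

Definition has_inverse_products (M : SymMonCat) (I : InverseStructure M) : Prop :=
  exists Delta : forall A : M, Hom A (A [x] A), is_inverse_product I Delta.

Definition is_discrete_inverse_category (M : SymMonCat) : Prop :=
  exists I : InverseStructure M, tensor_preserves_pinv I /\ has_inverse_products I.

(** * The category CNOT

  [circ n m] is the type of formal circuits from [n] wires to [m] wires.  The
  symmetries [c_swap n m : n + m -> m + n] belong to the free symmetric monoidal
  structure; the generating [sigma] is [c_swap 1 1]. *)

Inductive circ : nat -> nat -> Set :=
| c_id n : circ n n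
| c_comp n m p : circ n m -> circ m p -> circ n p
| c_tens n m n' m' : circ n n' -> circ m m' -> circ (n + m) (n' + m')
| c_swap n m : circ (n + m) (m + n)
| cnot : circ 2 2
| ket1 : circ 0 1
| bra1 : circ 1 0.

Declare Scope circ_scope.
Delimit Scope circ_scope with circ.
Bind Scope circ_scope with circ.
Notation "f ;; g" := (c_comp f g) : circ_scope.
Notation "f [*] g" := (c_tens f g) : circ_scope.

(** The identity map along a provable equality of objects.  The monoidal
  structure is strict, but [(n + m) + p] and [n + (m + p)] are not convertible;
  [c_idto] of such an equation is what the identity becomes. *)
Definition c_idto (n m : nat) (e : n = m) : circ n m :=
  match e with eq_refl => c_id n end.

Definition c_assoc (n m p : nat) : circ (n + m + p) (n + (m + p)) :=
  c_idto (eq_sym (Nat.add_assoc n m p)).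
Definition c_runit (n : nat) : circ (n + 0) n := c_idto (Nat.add_0_r n).

Definition sigma : circ 2 2 := c_swap 1 1.

(** [Ck_ij] is the cnot gate on [k] wires, with control [i] and target [j]. *)
Definition C2_12 : circ 2 2 := cnot.
Definition C2_21 : circ 2 2 := (sigma ;; cnot ;; sigma)%circ.
Definition C3_12 : circ 3 3 := (C2_12 [*] c_id 1)%circ.
Definition C3_21 : circ 3 3 := (C2_21 [*] c_id 1)%circ.
Definition C3_23 : circ 3 3 := (c_id 1 [*] C2_12)%circ.
Definition C3_32 : circ 3 3 := (c_id 1 [*] C2_21)%circ.
Definition C3_13 : circ 3 3 :=
  ((sigma [*] c_id 1) ;; C3_23 ;; (sigma [*] c_id 1))%circ.

Inductive cnot_rel : forall n m : nat, circ n m -> circ n m -> Prop :=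
| CNT1 : cnot_rel (C2_12 ;; C2_21 ;; C2_12) sigma
| CNT2 : cnot_rel (C2_12 ;; C2_12) (c_id 2)
| CNT3 : cnot_rel (C3_21 ;; C3_23) (C3_23 ;; C3_21)
| CNT4a : cnot_rel
    ((ket1 [*] c_id 1) ;; C2_12)
    ((ket1 [*] c_id 1) ;; C2_12 ;; (bra1 [*] c_id 1) ;; (ket1 [*] c_id 1))
| CNT4b : cnot_rel
    (C2_12 ;; (bra1 [*] c_id 1))
    ((bra1 [*] c_id 1) ;; (ket1 [*] c_id 1) ;; C2_12 ;; (bra1 [*] c_id 1))
| CNT5 : cnot_rel (C3_12 ;; C3_32) (C3_32 ;; C3_12)
| CNT6 : cnot_rel (ket1 ;; bra1) (c_id 0)
| CNT7a : cnot_rel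
    ((ket1 [*] ket1 [*] c_id 1) ;; C3_12 ;; C3_23 ;; (bra1 [*] c_id 2))
    ((ket1 [*] ket1 [*] c_id 1) ;; C3_12 ;; (bra1 [*] c_id 2))
| CNT7b : cnot_rel
    ((ket1 [*] c_id 2) ;; C3_23 ;; C3_12 ;; (bra1 [*] bra1 [*] c_id 1))
    ((ket1 [*] c_id 2) ;; C3_12 ;; (bra1 [*] bra1 [*] c_id 1))
| CNT8 : cnot_rel (C3_12 ;; C3_23 ;; C3_12) (C3_23 ;; C3_13)
| CNT9 : cnot_rel
    ((ket1 [*] ket1 [*] c_id 1) ;; C3_12 ;; (bra1 [*] bra1 [*] c_id 1))
    ((ket1 [*] ket1 [*] bra1) ;; C2_12 ;; (bra1 [*] bra1 [*] ket1)).

(** The congruence generated by the laws of a strict symmetric monoidal category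
  and [cnot_rel].  Strictness is [ceq_assoc], [ceq_lunit] and [ceq_runit]: the
  associators and unitors are identities. *)
Inductive ceq : forall n m : nat, circ n m -> circ n m -> Prop :=
| ceq_refl n m (f : circ n m) : ceq f f
| ceq_sym n m (f g : circ n m) : ceq f g -> ceq g f
| ceq_trans n m (f g h : circ n m) : ceq f g -> ceq g h -> ceq f h
| ceq_comp n m p (f f' : circ n m) (g g' : circ m p) :
    ceq f f' -> ceq g g' -> ceq (f ;; g) (f' ;; g')
| ceq_tens n m n' m' (f f' : circ n n') (g g' : circ m m') :
    ceq f f' -> ceq g g' -> ceq (f [*] g) (f' [*] g')
| ceq_comp_idl n m (f : circ n m) : ceq (c_id n ;; f) f
| ceq_comp_idr n m (f : circ n m) : ceq (f ;; c_id m) f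
| ceq_comp_assoc n m p q (f : circ n m) (g : circ m p) (h : circ p q) :
    ceq (f ;; g ;; h) (f ;; (g ;; h))
| ceq_tens_id n m : ceq (c_id n [*] c_id m) (c_id (n + m))
| ceq_tens_comp n m n' m' n'' m''
    (f : circ n n') (f' : circ n' n'') (g : circ m m') (g' : circ m' m'') :
    ceq ((f ;; f') [*] (g ;; g')) ((f [*] g) ;; (f' [*] g'))
| ceq_assoc n m p n' m' p' (f : circ n n') (g : circ m m') (h : circ p p') :
    ceq ((f [*] g [*] h) ;; c_assoc n' m' p') (c_assoc n m p ;; (f [*] (g [*] h)))
| ceq_lunit n m (f : circ n m) : ceq (c_id 0 [*] f) f
| ceq_runit n m (f : circ n m) : ceq ((f [*] c_id 0) ;; c_runit m) (c_runit n ;; f)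
| ceq_swap_nat n m n' m' (f : circ n n') (g : circ m m') :
    ceq ((f [*] g) ;; c_swap n' m') (c_swap n m ;; (g [*] f))
| ceq_swapK n m : ceq (c_swap n m ;; c_swap m n) (c_id (n + m))
| ceq_hexagon n m p :
    ceq (c_assoc n m p ;; c_swap n (m + p) ;; c_assoc m p n)
        ((c_swap n m [*] c_id p) ;; c_assoc m n p ;; (c_id m [*] c_swap n p))
| ceq_rel n m (f g : circ n m) : cnot_rel f g -> ceq f g.

#[export] Instance ceq_equiv n m : Equivalence (@ceq n m).
Proof.
  split; [exact (@ceq_refl n m) | exact (@ceq_sym n m) | exact (@ceq_trans n m)].
Qed.

#[export] Instance c_comp_proper n m p :
  Proper (@ceq n m ==> @ceq m p ==> @ceq n p) (@c_comp n m p).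
Proof. intros f f' Hf g g' Hg; exact (ceq_comp Hf Hg). Qed.

#[export] Instance c_tens_proper n m n' m' :
  Proper (@ceq n n' ==> @ceq m m' ==> @ceq (n + m) (n' + m')) (@c_tens n m n' m').
Proof. intros f f' Hf g g' Hg; exact (ceq_tens Hf Hg). Qed.

Lemma c_idto_irrel n m (e e' : n = m) : ceq (c_idto e) (c_idto e').
Proof. rewrite (UIP_dec Nat.eq_dec e e'). reflexivity. Qed.

Lemma c_idto_id n (e : n = n) : ceq (c_idto e) (c_id n).
Proof. exact (c_idto_irrel e eq_refl). Qed.

Lemma c_idto_comp n m p (e : n = m) (e' : m = p) :
  ceq (c_idto e ;; c_idto e') (c_idto (eq_trans e e')).
Proof. destruct e'; destruct e; apply ceq_comp_idl. Qed.

Lemma c_idto_tens n m n' m' (e : n = n') (e' : m = m') (e'' : n + m = n' + m') :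
  ceq (c_idto e [*] c_idto e') (c_idto e'').
Proof.
  destruct e; destruct e'.
  transitivity (c_id (n + m)); [exact (ceq_tens_id n m) |].
  symmetry; apply c_idto_id.
Qed.

Lemma c_assoc_pentagon n m p q :
  ceq (c_assoc (n + m) p q ;; c_assoc n m (p + q))
      ((c_assoc n m p [*] c_id q) ;; c_assoc n (m + p) q
         ;; (c_id n [*] c_assoc m p q)).
Proof.
  change (c_id q) with (c_idto (eq_refl q)).
  change (c_id n) with (c_idto (eq_refl n)).
  unfold c_assoc.
  rewrite (c_idto_tens _ _ (f_equal (fun k => k + q) (eq_sym (Nat.add_assoc n m p)))).
  rewrite (c_idto_tens _ _ (f_equal (Nat.add n) (eq_sym (Nat.add_assoc m p q)))).
  rewrite !c_idto_comp. apply c_idto_irrel.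
Qed.

Lemma c_assoc_triangle n m :
  ceq (c_assoc n 0 m ;; (c_id n [*] c_id m)) (c_runit n [*] c_id m).
Proof.
  transitivity (c_assoc n 0 m).
  - transitivity (c_assoc n 0 m ;; c_id (n + m))%circ.
    + exact (ceq_comp (ceq_refl (c_assoc n 0 m)) (ceq_tens_id n m)).
    + apply ceq_comp_idr.
  - symmetry. exact (c_idto_tens (Nat.add_0_r n) (eq_refl m) _).
Qed.

Lemma c_idto_compK n m (e : n = m) (e' : m = n) :
  ceq (c_idto e ;; c_idto e') (c_id n).
Proof. rewrite c_idto_comp. apply c_idto_id. Qed.

Lemma c_lunit_nat n m (f : circ n m) : ceq ((c_id 0 [*] f) ;; c_id m) (c_id n ;; f).
Proof. rewrite ceq_comp_idl, (ceq_comp_idr (c_id 0 [*] f)). apply ceq_lunit. Qed.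

Definition CNOT_cat : Category := {|
  Ob := nat;
  Hom := circ;
  heq := ceq;
  idm := c_id;
  comp := c_comp;
  heq_equiv := ceq_equiv;
  comp_proper := c_comp_proper;
  comp_idl := ceq_comp_idl;
  comp_idr := ceq_comp_idr;
  comp_assoc := ceq_comp_assoc
|}.

Definition CNOT : SymMonCat := {|
  smc_cat := CNOT_cat;
  unit_ob := 0 : CNOT_cat;
  tens := Nat.add : CNOT_cat -> CNOT_cat -> CNOT_cat;
  tensm := c_tens;
  assoc := c_assoc;
  associ := fun n m p => c_idto (Nat.add_assoc n m p);
  lunit := c_id;
  luniti := c_id;
  runit := c_runit;
  runiti := fun n => c_idto (eq_sym (Nat.add_0_r n));
  sym := c_swap;
  tensm_proper := c_tens_proper;
  tensm_id := ceq_tens_id;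
  tensm_comp := ceq_tens_comp;
  assoc_nat := ceq_assoc;
  lunit_nat := c_lunit_nat;
  runit_nat := ceq_runit;
  sym_nat := ceq_swap_nat;
  assocK := fun n m p => c_idto_compK _ _;
  associK := fun n m p => c_idto_compK _ _;
  lunitK := fun n => ceq_comp_idl (c_id n);
  lunitiK := fun n => ceq_comp_idl (c_id n);
  runitK := fun n => c_idto_compK _ _;
  runitiK := fun n => c_idto_compK _ _;
  symK := ceq_swapK;
  pentagon := c_assoc_pentagon;
  triangle := c_assoc_triangle;
  hexagon := ceq_hexagon
|}.

(* Main.v *)
(** Write [f°] for the mirror image of a circuit [f], and let [Δ] copy a wire by a
  cnot onto a fresh |0>.  The relations of CNOT make [Δ] cocommutative,
  coassociative, semi-Frobenius and natural for every generator.  Moreover every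
  circuit satisfies the graph equation [Δ (f ⊗ 1) = f Δ (1 ⊗ f°)]: it holds for the
  generators, and it is stable under composition and tensor.  Together with
  naturality and [Δ Δ° = 1], the graph equations of [f] and [f°] give [f f° f = f],
  and those of [e = f f°] give [Δ (e ⊗ 1) = e Δ], hence such idempotents commute.
  The bookkeeping of wires is discharged by coherence: two circuits made of
  symmetries and identities are equal as soon as they move every wire to the same
  position.  Indeed each is equal to the circuit that inserts the wires one by one at
  their target positions, because these circuits compose like permutations. *)

From Stdlib Require Import Setoid Morphisms Arith Lia List.
Import ListNotations.
Require Import Defs.

Set Implicit Arguments.
Unset Strict Implicit.
Unset Printing Implicit Defensive.

(** * Inverse categories from an involution *)

Record Involution (C : Category) := {
  dagger : forall A B : C, Hom A B -> Hom B A;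
  dagger_proper : forall A B, Proper (heq ==> heq) (@dagger A B);
  daggerK : forall A B (f : Hom A B), dagger (dagger f) ≈ f;
  dagger_comp : forall A B D (f : Hom A B) (g : Hom B D),
    dagger (f ;; g) ≈ dagger g ;; dagger f
}.

#[local] Existing Instance dagger_proper.

Section InvolutionInverse.

Variables (C : Category) (I : Involution C).

Local Notation "f °" := (dagger I f) (at level 9, format "f °") : cat_scope.

Hypothesis comp_dagger_comp : forall (A B : C) (f : Hom A B), f ;; f° ;; f ≈ f.
Hypothesis dagger_idem_comm : forall (A B D : C) (f : Hom A B) (g : Hom A D),
  f ;; f° ;; (g ;; g°) ≈ g ;; g° ;; (f ;; f°).

Definition involution_restriction : RestrictionStructure C.
Proof.
  refine {| restr := fun A B f => f ;; f° |}.
  - intros A B f g fg. rewrite fg. reflexivity.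
  - exact comp_dagger_comp.
  - exact dagger_idem_comm.
  - intros A B D f g. rewrite !dagger_comp, daggerK.
    rewrite (comp_assoc (g ;; g°) f), <- (comp_assoc f f°).
    rewrite dagger_idem_comm, <- (comp_assoc (g ;; g°) (g ;; g°)).
    rewrite <- (comp_assoc (g ;; g°) g), comp_dagger_comp. reflexivity.
  - intros A B D f g. rewrite dagger_comp.
    pose proof (dagger_idem_comm g f°) as idem_comm. rewrite daggerK in idem_comm.
    rewrite !comp_assoc in idem_comm.
    rewrite !comp_assoc, idem_comm, <- !comp_assoc, comp_dagger_comp. reflexivity.
Defined.

Lemma dagger_partial_inverse (A B : C) (f : Hom A B) :
  is_partial_inverse involution_restriction f f°.
Proof. split; simpl; [|rewrite daggerK]; reflexivity. Qed.

Definition involution_inverse : InverseStructure C := {|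
  inv_restr := involution_restriction;
  pinv := @dagger C I;
  pinv_proper := dagger_proper I;
  pinvP := dagger_partial_inverse
|}.

End InvolutionInverse.

Section CopyingInverse.

Variables (M : SymMonCat) (I : Involution M).
Variable Delta : forall A : M, Hom A (A [x] A).

Local Notation "f °" := (dagger I f) (at level 9, format "f °") : cat_scope.

Hypothesis Delta_retract : forall A, Delta A ;; (Delta A)° ≈ idm A.
Hypothesis Delta_natural : forall (A B : M) (f : Hom A B),
  f ;; Delta B ≈ Delta A ;; (f [*] f).
Hypothesis Delta_sym : forall A, Delta A ;; sym A A ≈ Delta A.
Hypothesis Delta_graph : forall (A B : M) (f : Hom A B),
  Delta A ;; (f [*] idm A) ≈ f ;; Delta B ;; (idm B [*] f°).

Lemma Delta_cancel (A B : M) (f g : Hom A B) : f ;; Delta B ≈ g ;; Delta B -> f ≈ g.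
Proof.
  intro fg. rewrite <- (comp_idr f), <- (comp_idr g), <- (Delta_retract B).
  rewrite <- !comp_assoc, fg. reflexivity.
Qed.

Lemma Delta_swap_sides (A B : M) (f : Hom A B) :
  Delta A ;; (idm A [*] f) ≈ Delta A ;; (f [*] idm A) ;; sym B A.
Proof. rewrite comp_assoc, sym_nat, <- comp_assoc, Delta_sym. reflexivity. Qed.

Lemma Delta_graph_r (A B : M) (f : Hom A B) :
  Delta A ;; (idm A [*] f) ≈ f ;; Delta B ;; (f° [*] idm B).
Proof.
  rewrite Delta_swap_sides, Delta_graph, comp_assoc, sym_nat.
  rewrite <- comp_assoc, (comp_assoc f), Delta_sym. reflexivity.
Qed.

Lemma Delta_comp_dagger_comp (A B : M) (f : Hom A B) : f ;; f° ;; f ≈ f.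
Proof.
  assert (graph_dagger : Delta A ;; (f [*] idm A) ≈ f ;; f° ;; Delta A ;; (f [*] idm A)).
  { rewrite Delta_graph, (comp_assoc f), Delta_graph_r, daggerK, <- !comp_assoc.
    reflexivity. }
  assert (f_f : f [*] f ≈ (f [*] idm A) ;; (idm B [*] f)).
  { rewrite <- tensm_comp, comp_idl, comp_idr. reflexivity. }
  apply Delta_cancel. rewrite (comp_assoc (f ;; f°)), Delta_natural, f_f.
  rewrite <- !comp_assoc, <- graph_dagger. reflexivity.
Qed.

Lemma Delta_idem_l (A B : M) (f : Hom A B) :
  Delta A ;; ((f ;; f°) [*] idm A) ≈ f ;; f° ;; Delta A.
Proof.
  rewrite Delta_graph, dagger_comp, daggerK, Delta_natural, comp_assoc, <- tensm_comp.
  rewrite comp_idr, <- (comp_assoc (f ;; f°) f), Delta_comp_dagger_comp. reflexivity.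
Qed.

Lemma Delta_idem_r (A B : M) (f : Hom A B) :
  Delta A ;; (idm A [*] (f ;; f°)) ≈ f ;; f° ;; Delta A.
Proof. rewrite Delta_swap_sides, Delta_idem_l, comp_assoc, Delta_sym. reflexivity. Qed.

Lemma Delta_idem_comm (A B D : M) (f : Hom A B) (g : Hom A D) :
  f ;; f° ;; (g ;; g°) ≈ g ;; g° ;; (f ;; f°).
Proof.
  apply Delta_cancel.
  rewrite (comp_assoc _ (g ;; g°)), <- (Delta_idem_r g), <- comp_assoc, <- Delta_idem_l.
  rewrite (comp_assoc _ (f ;; f°)), <- (Delta_idem_l f), <- comp_assoc, <- Delta_idem_r.
  rewrite !(comp_assoc (Delta A)), <- !tensm_comp, !comp_idl, !comp_idr. reflexivity.
Qed.

Definition copying_inverse : InverseStructure M :=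
  involution_inverse Delta_comp_dagger_comp Delta_idem_comm.

End CopyingInverse.

(** * Circuits of identities and symmetries *)

Local Open Scope circ_scope.
Local Notation "f ≅ g" := (ceq f g) (at level 70, no associativity).

Lemma tens_split n n' m m' (f : circ n n') (g : circ m m') :
  f [*] g ≅ (f [*] c_id m) ;; (c_id n' [*] g).
Proof. rewrite <- ceq_tens_comp, ceq_comp_idl, ceq_comp_idr. reflexivity. Qed.

Lemma tens_split_r n n' m m' (f : circ n n') (g : circ m m') :
  f [*] g ≅ (c_id n [*] g) ;; (f [*] c_id m').
Proof. rewrite <- ceq_tens_comp, ceq_comp_idl, ceq_comp_idr. reflexivity. Qed.

Lemma tens_interchange n n' m m' (f : circ n n') (g : circ m m') :
  (f [*] c_id m) ;; (c_id n' [*] g) ≅ (c_id n [*] g) ;; (f [*] c_id m').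
Proof. rewrite <- tens_split. apply tens_split_r. Qed.

Lemma tens_comp_l n n' n'' m (f : circ n n') (g : circ n' n'') :
  (f ;; g) [*] c_id m ≅ (f [*] c_id m) ;; (g [*] c_id m).
Proof. rewrite <- ceq_tens_comp, ceq_comp_idl. reflexivity. Qed.

Lemma tens_comp_r n m m' m'' (f : circ m m') (g : circ m' m'') :
  c_id n [*] (f ;; g) ≅ (c_id n [*] f) ;; (c_id n [*] g).
Proof. rewrite <- ceq_tens_comp, ceq_comp_idl. reflexivity. Qed.

Lemma tens_assoc_idto n m p n' m' p' (f : circ n n') (g : circ m m') (h : circ p p')
    (e : n + m + p = n + (m + p)) (e' : n' + m' + p' = n' + (m' + p')) :
  (f [*] g [*] h) ;; c_idto e' ≅ c_idto e ;; (f [*] (g [*] h)).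
Proof.
  rewrite (c_idto_irrel e (eq_sym (Nat.add_assoc n m p))).
  rewrite (c_idto_irrel e' (eq_sym (Nat.add_assoc n' m' p'))).
  apply ceq_assoc.
Qed.

Lemma tens_id0_idto n m (f : circ n m) (e : n + 0 = n) (e' : m + 0 = m) :
  (f [*] c_id 0) ;; c_idto e' ≅ c_idto e ;; f.
Proof.
  rewrite (c_idto_irrel e (Nat.add_0_r n)), (c_idto_irrel e' (Nat.add_0_r m)).
  apply ceq_runit.
Qed.

Lemma hexagon_idto n m p (e1 : n + (m + p) = n + m + p)
    (e2 : m + n + p = m + (n + p)) (e3 : m + (p + n) = m + p + n) :
  c_swap n (m + p) ≅
  c_idto e1 ;; (c_swap n m [*] c_id p) ;; c_idto e2 ;; (c_id m [*] c_swap n p) ;; c_idto e3.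
Proof.
  rewrite (c_idto_irrel e2 (eq_sym (Nat.add_assoc m n p))).
  rewrite !(ceq_comp_assoc (c_idto e1)), <- (ceq_hexagon n m p). unfold c_assoc.
  rewrite !ceq_comp_assoc, c_idto_compK, ceq_comp_idr, <- ceq_comp_assoc, c_idto_compK.
  symmetry; apply ceq_comp_idl.
Qed.

Lemma comp_id_square n m (f g : circ n m) : f ;; c_id m ≅ c_id n ;; g -> f ≅ g.
Proof. rewrite ceq_comp_idl, ceq_comp_idr. auto. Qed.

(* For circuits whose coherence isomorphisms are identities up to conversion. *)
Local Notation strict_assoc f g h :=
  (comp_id_square (@tens_assoc_idto _ _ _ _ _ _ f g h eq_refl eq_refl)).
Local Notation strict_runit f :=
  (comp_id_square (@tens_id0_idto _ _ f eq_refl eq_refl)).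

Definition shift n m (f : circ n m) : circ (S n) (S m) := c_id 1 [*] f.

#[local] Instance shift_proper n m : Proper (@ceq n m ==> @ceq (S n) (S m)) (@shift n m).
Proof. intros f g fg. unfold shift. rewrite fg. reflexivity. Qed.

Lemma shift_id n : shift (c_id n) ≅ c_id (S n).
Proof. apply (ceq_tens_id 1 n). Qed.

Lemma shift_comp n m p (f : circ n m) (g : circ m p) : shift (f ;; g) ≅ shift f ;; shift g.
Proof. apply (tens_comp_r 1 f g). Qed.

Lemma shift_tens n m n' m' (f : circ n n') (g : circ m m') : shift f [*] g ≅ shift (f [*] g).
Proof. exact (strict_assoc (c_id 1) f g). Qed.

Lemma shift_shift n m (f : circ n m) : shift (shift f) ≅ c_id 2 [*] f.
Proof. rewrite <- (ceq_tens_id 1 1). symmetry. apply (shift_tens (c_id 1) f). Qed.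

Definition swap_top k : circ (S (S k)) (S (S k)) := sigma [*] c_id k.

Lemma swap_topK k : swap_top k ;; swap_top k ≅ c_id (S (S k)).
Proof.
  unfold swap_top. rewrite <- (ceq_tens_comp sigma sigma (c_id k) (c_id k)), ceq_comp_idl.
  rewrite (ceq_swapK 1 1). apply (ceq_tens_id 2 k).
Qed.

Lemma swap_top_tens k m : swap_top k [*] c_id m ≅ swap_top (k + m).
Proof.
  unfold swap_top. rewrite (strict_assoc sigma (c_id k) (c_id m)), ceq_tens_id. reflexivity.
Qed.

Lemma swap_top_shift_shift n m (f : circ n m) :
  swap_top n ;; shift (shift f) ≅ shift (shift f) ;; swap_top m.
Proof. rewrite !shift_shift. apply (tens_interchange sigma f). Qed.

Lemma swap_one_succ p : c_swap 1 (S p) ≅ swap_top p ;; shift (c_swap 1 p).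
Proof.
  etransitivity; [exact (@hexagon_idto 1 1 p eq_refl eq_refl eq_refl)|]. simpl c_idto.
  rewrite ceq_comp_idr, ceq_comp_idl, ceq_comp_idr. reflexivity.
Qed.

Lemma swap_top_braid k :
  swap_top (S k) ;; shift (swap_top k) ;; swap_top (S k) ≅
  shift (swap_top k) ;; swap_top (S k) ;; shift (swap_top k).
Proof.
  assert (braid3 : swap_top 1 ;; shift sigma ;; swap_top 1 ≅
                   shift sigma ;; swap_top 1 ;; shift sigma).
  { assert (swap12 : c_swap 1 2 ≅ swap_top 1 ;; shift sigma) by exact (swap_one_succ 1).
    rewrite (ceq_comp_assoc (shift sigma)), <- swap12. symmetry.
    exact (ceq_swap_nat (c_id 1) sigma). }
  transitivity ((swap_top 1 ;; shift sigma ;; swap_top 1) [*] c_id k).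
  - rewrite !tens_comp_l, swap_top_tens, shift_tens. reflexivity.
  - rewrite braid3, !tens_comp_l, swap_top_tens, shift_tens. reflexivity.
Qed.

(** [insert k j] moves wire [0] to position [j]. *)
Fixpoint insert (k j : nat) : circ (S k) (S k) :=
  match k return circ (S k) (S k) with
  | 0 => c_id 1
  | S k' => match j with 0 => c_id _ | S j' => swap_top k' ;; shift (insert k' j') end
  end.

Lemma insert_0 k : insert k 0 = c_id (S k).
Proof. destruct k; reflexivity. Qed.

Lemma insert_tens k m j : j <= k -> insert k j [*] c_id m ≅ insert (k + m) j.
Proof.
  revert j; induction k as [|k IH]; intros [|j] jk; simpl insert; try lia.
  - rewrite insert_0. apply (ceq_tens_id 1 m).
  - apply (ceq_tens_id (S (S k)) m).
  - rewrite (tens_comp_l m (swap_top k) (shift (insert k j))), swap_top_tens, shift_tens.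
    rewrite IH by lia. reflexivity.
Qed.

Definition bump j x := if x <? j then x else S x.
Definition unbump j x := if x <? j then x else pred x.

(* Innermost comparisons first: [lia] does not see through the outer ones. *)
Ltac case_ltb :=
  match goal with
  | |- context [?a <? ?b] =>
    lazymatch constr:((a, b)) with
    | context [_ <? _] => fail
    | _ => destruct (Nat.ltb_spec a b); try lia
    end
  end.

Ltac cases_ltb := repeat case_ltb; try lia.

Lemma bump_unbump j x : x <> j -> bump j (unbump j x) = x.
Proof. unfold bump, unbump. cases_ltb. Qed.

Lemma bump_succ j x : bump (S j) (S x) = S (bump j x).
Proof. unfold bump. cases_ltb. Qed.

Lemma unbump_unbump a b c : a <> b -> a <> c -> b <> c ->
  unbump (unbump b a) (unbump b c) = unbump (unbump a b) (unbump a c).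
Proof. unfold unbump. cases_ltb. Qed.

Lemma insert_insert_lt k b c : b < c -> c <= S k ->
  swap_top k ;; shift (insert k (pred c)) ;; insert (S k) b ≅
  shift (insert k b) ;; insert (S k) c.
Proof.
  revert b c; induction k as [|k IH]; intros [|b] [|[|c]] bc ck; try lia.
  1, 2, 3: cbn [insert pred];
    rewrite ?insert_0, shift_id, ceq_comp_idl, ceq_comp_idr; reflexivity.
  change (insert (S k) (pred (S (S c)))) with (swap_top k ;; shift (insert k c)).
  change (insert (S k) (S b)) with (swap_top k ;; shift (insert k b)).
  change (insert (S (S k)) (S b)) with (swap_top (S k) ;; shift (insert (S k) b)).
  change (insert (S (S k)) (S (S c))) with (swap_top (S k) ;; shift (insert (S k) (S c))).
  rewrite !shift_comp, <- !ceq_comp_assoc.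
  rewrite (ceq_comp_assoc _ _ (swap_top (S k))), <- swap_top_shift_shift, <- ceq_comp_assoc.
  rewrite swap_top_braid.
  rewrite (ceq_comp_assoc _ _ (swap_top (S k))), <- swap_top_shift_shift.
  rewrite !ceq_comp_assoc, <- !shift_comp, <- ceq_comp_assoc.
  rewrite <- (IH b (S c)) by lia. rewrite !ceq_comp_assoc. reflexivity.
Qed.

Lemma insert_insert k b c : b <> c -> b <= S k -> c <= S k ->
  swap_top k ;; shift (insert k (unbump b c)) ;; insert (S k) b ≅
  shift (insert k (unbump c b)) ;; insert (S k) c.
Proof.
  intros b_c bk ck. unfold unbump.
  destruct (Nat.ltb_spec c b), (Nat.ltb_spec b c); try lia.
  - rewrite ceq_comp_assoc, <- insert_insert_lt by lia.
    rewrite <- !ceq_comp_assoc, swap_topK, ceq_comp_idl. reflexivity.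
  - apply insert_insert_lt; lia.
Qed.

(** [perm_circ n q] sends wire [i] to position [q i]. *)
Fixpoint perm_circ (n : nat) (q : nat -> nat) : circ n n :=
  match n with
  | 0 => c_id 0
  | S k => shift (perm_circ k (fun x => unbump (q 0) (q (S x)))) ;; insert k (q 0)
  end.

Definition perm_on n (q : nat -> nat) :=
  (forall i, i < n -> q i < n) /\
  (forall i j, i < n -> j < n -> q i = q j -> i = j).

Lemma perm_circ_ext n q r : (forall i, i < n -> q i = r i) -> perm_circ n q = perm_circ n r.
Proof.
  revert q r; induction n as [|n IH]; intros q r qr; simpl; [reflexivity|].
  rewrite (qr 0) by lia.
  rewrite (IH _ (fun x => unbump (r 0) (r (S x)))); [reflexivity|].
  intros i i_lt. rewrite (qr (S i)) by lia. reflexivity.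
Qed.

Lemma perm_on_ext n q r : (forall i, i < n -> q i = r i) -> perm_on n r -> perm_on n q.
Proof.
  intros qr [r_lt r_inj]. split.
  - intros i i_lt. rewrite qr by assumption. auto.
  - intros i j i_lt j_lt. rewrite !qr by assumption. auto.
Qed.

Lemma perm_on_comp n q r : perm_on n q -> perm_on n r -> perm_on n (fun x => r (q x)).
Proof. intros [q_lt q_inj] [r_lt r_inj]. split; auto. Qed.

Lemma perm_on_remove n q i : i <= n -> perm_on (S n) q ->
  perm_on n (fun x => unbump (q i) (q (bump i x))).
Proof.
  intros i_le [q_lt q_inj].
  assert (bump_lt : forall x, x < n -> bump i x < S n) by (intro; unfold bump; cases_ltb).
  assert (bump_ne : forall x, x < n -> q (bump i x) <> q i).
  { intros x x_lt q_eq. apply q_inj in q_eq; auto with arith.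
    revert q_eq. unfold bump. cases_ltb. }
  pose proof (q_lt i). split.
  - intros x x_lt. pose proof (q_lt _ (bump_lt x x_lt)).
    pose proof (bump_ne x x_lt). unfold unbump. cases_ltb.
  - intros x y x_lt y_lt q_eq.
    assert (q_bump : q (bump i x) = q (bump i y))
      by (rewrite <- (@bump_unbump (q i) (q (bump i x))), q_eq, bump_unbump; auto).
    apply q_inj in q_bump; auto. revert q_bump. unfold bump. cases_ltb.
Qed.

Lemma perm_circ_id n q : (forall i, i < n -> q i = i) -> perm_circ n q ≅ c_id n.
Proof.
  revert q; induction n as [|n IH]; intros q q_id; simpl; [reflexivity|].
  rewrite q_id by lia. rewrite insert_0, ceq_comp_idr, IH; [apply shift_id|].
  intros i i_lt. rewrite q_id by lia. reflexivity.
Qed.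

Lemma perm_circ_tens n m q : perm_on n q ->
  perm_circ n q [*] c_id m ≅ perm_circ (n + m) (fun x => if x <? n then q x else x).
Proof.
  revert q; induction n as [|n IH]; intros q q_perm.
  - rewrite (@perm_circ_id (0 + m)) by reflexivity. apply ceq_tens_id.
  - assert (q0 : q 0 < S n) by (apply q_perm; lia).
    cbn [perm_circ Nat.add]. rewrite (tens_comp_l m (shift _) (insert n (q 0))), shift_tens.
    rewrite insert_tens, IH by (lia || exact (perm_on_remove (Nat.le_0_l n) q_perm)).
    erewrite perm_circ_ext; [reflexivity|]. intros i i_lt. simpl.
    unfold unbump. cases_ltb.
Qed.

Lemma insert_perm_circ k r i : perm_on (S k) r -> i <= k ->
  insert k i ;; perm_circ (S k) r ≅
  shift (perm_circ k (fun x => unbump (r i) (r (bump i x)))) ;; insert k (r i).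
Proof.
  revert r i; induction k as [|k IH]; intros r [|i] r_perm ik; try lia.
  1, 2: rewrite insert_0; apply ceq_comp_idl.
  pose proof (perm_on_remove (Nat.le_0_l (S k)) r_perm) as tail_perm.
  destruct r_perm as [r_lt r_inj].
  assert (r_ne : forall x y, x < S (S k) -> y < S (S k) -> x <> y -> r x <> r y)
    by (intros; intro r_eq; apply r_inj in r_eq; auto).
  change (insert (S k) (S i)) with (swap_top k ;; shift (insert k i)).
  change (perm_circ (S (S k)) r)
    with (shift (perm_circ (S k) (fun x => unbump (r 0) (r (S x)))) ;; insert (S k) (r 0)).
  rewrite ceq_comp_assoc, <- (ceq_comp_assoc (shift _)), <- shift_comp.
  rewrite IH by (lia || exact tail_perm).
  rewrite shift_comp, <- !ceq_comp_assoc, swap_top_shift_shift, !ceq_comp_assoc.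
  rewrite <- (ceq_comp_assoc (swap_top k)).
  rewrite insert_insert by first [apply r_ne; lia | apply Nat.lt_succ_r, r_lt; lia].
  rewrite <- !ceq_comp_assoc, <- shift_comp. cbn [perm_circ].
  erewrite perm_circ_ext; [reflexivity|]. intros x x_lt. cbn beta. rewrite bump_succ.
  apply unbump_unbump; apply r_ne; unfold bump; cases_ltb.
Qed.

Lemma perm_circ_comp n q r : perm_on n q -> perm_on n r ->
  perm_circ n q ;; perm_circ n r ≅ perm_circ n (fun x => r (q x)).
Proof.
  revert q r; induction n as [|n IH]; intros q r q_perm r_perm; [apply ceq_comp_idl|].
  assert (q0 : q 0 <= n) by (apply Nat.lt_succ_r, q_perm; lia).
  change (perm_circ (S n) q)
    with (shift (perm_circ n (fun x => unbump (q 0) (q (S x)))) ;; insert n (q 0)).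
  rewrite ceq_comp_assoc, insert_perm_circ, <- ceq_comp_assoc, <- shift_comp by assumption.
  rewrite IH;
    [| exact (perm_on_remove (Nat.le_0_l n) q_perm) | exact (perm_on_remove q0 r_perm)].
  cbn [perm_circ]. erewrite perm_circ_ext; [reflexivity|]. intros x x_lt. cbn beta.
  rewrite bump_unbump; [reflexivity|].
  intro q_eq. apply q_perm in q_eq; lia.
Qed.

Fixpoint is_wiring n m (f : circ n m) : Prop :=
  match f with
  | c_id _ => True
  | c_comp f g => is_wiring f /\ is_wiring g
  | c_tens f g => is_wiring f /\ is_wiring g
  | c_swap _ _ => True
  | _ => False
  end.

(** [route f i] is the output position of input wire [i]; it is meaningful only if
  [is_wiring f] and [i] is in range. *)
Fixpoint route n m (f : circ n m) (i : nat) : nat :=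
  match f with
  | c_id _ => i
  | c_comp f g => route g (route f i)
  | @c_tens n _ n' _ f g => if i <? n then route f i else n' + route g (i - n)
  | c_swap n m => if i <? n then m + i else i - n
  | _ => i
  end.

Lemma is_wiring_idto n m (e : n = m) : is_wiring (c_idto e).
Proof. destruct e. exact I. Qed.

Lemma route_idto n m (e : n = m) i : route (c_idto e) i = i.
Proof. destruct e. reflexivity. Qed.

Lemma route_shift_succ n m (f : circ n m) i : route (shift f) (S i) = S (route f i).
Proof. simpl. rewrite Nat.sub_0_r. reflexivity. Qed.

Definition canonical n m (f : circ n m) :=
  n = m /\ perm_on n (route f) /\ forall e : m = n, f ;; c_idto e ≅ perm_circ n (route f).

Lemma canonical_endo n (f : circ n n) :
  perm_on n (route f) -> f ≅ perm_circ n (route f) -> canonical f.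
Proof.
  intros f_perm f_perm_circ. split; [reflexivity|]. split; [exact f_perm|].
  intro e. rewrite c_idto_id, ceq_comp_idr. exact f_perm_circ.
Qed.

Lemma canonical_perm_circ n (f : circ n n) : canonical f -> f ≅ perm_circ n (route f).
Proof.
  intros [_ [_ f_perm_circ]]. rewrite <- (f_perm_circ eq_refl). symmetry. apply ceq_comp_idr.
Qed.

Lemma canonical_ceq n m (f g : circ n m) : f ≅ g ->
  (forall i, i < n -> route f i = route g i) -> canonical g -> canonical f.
Proof.
  intros f_g route_eq [n_m [g_perm g_perm_circ]].
  split; [exact n_m|]. split; [exact (perm_on_ext route_eq g_perm)|].
  intro e. rewrite (perm_circ_ext route_eq), f_g. apply g_perm_circ.
Qed.

Lemma canonical_idto n m (e : n = m) : canonical (c_idto e).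
Proof.
  destruct e. apply canonical_endo; [split; auto|].
  symmetry. apply perm_circ_id. reflexivity.
Qed.

Lemma canonical_comp n m p (f : circ n m) (g : circ m p) :
  canonical f -> canonical g -> canonical (f ;; g).
Proof.
  intros f_can g_can. destruct (proj1 f_can), (proj1 g_can).
  apply canonical_endo; cbn [route].
  - apply (perm_on_comp (proj1 (proj2 f_can)) (proj1 (proj2 g_can))).
  - etransitivity; [exact (ceq_comp (canonical_perm_circ f_can) (canonical_perm_circ g_can))|].
    apply perm_circ_comp; [apply f_can | apply g_can].
Qed.

Lemma canonical_inverse n m (f : circ n m) (g : circ m n) : f ;; g ≅ c_id n ->
  (forall i, i < n -> route f (route g i) = i) ->
  (forall i, i < n -> route g i < n) -> canonical f -> canonical g.
Proof.
  intros fg_id route_K g_lt f_can. destruct (proj1 f_can).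
  destruct (proj1 (proj2 f_can)) as [f_lt f_inj].
  assert (g_perm : perm_on n (route g)).
  { split; [exact g_lt|]. intros i j i_lt j_lt g_eq.
    rewrite <- (route_K i), <- (route_K j), g_eq by assumption. reflexivity. }
  apply canonical_endo; [exact g_perm|].
  assert (gf_id : perm_circ n (route g) ;; f ≅ c_id n).
  { etransitivity; [exact (ceq_comp (ceq_refl _) (canonical_perm_circ f_can))|].
    rewrite perm_circ_comp by (assumption || apply f_can). apply perm_circ_id, route_K. }
  etransitivity; [symmetry; apply ceq_comp_idl|].
  rewrite <- gf_id, ceq_comp_assoc, fg_id. apply ceq_comp_idr.
Qed.

Lemma canonical_shift n m (f : circ n m) : canonical f -> canonical (shift f).
Proof.
  intro f_can. destruct (proj1 f_can), (proj1 (proj2 f_can)) as [f_lt f_inj].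
  apply canonical_endo.
  - split.
    + intros [|i] i_lt; [simpl; lia|]. rewrite route_shift_succ.
      pose proof (f_lt i). lia.
    + intros [|i] [|j] i_lt j_lt; rewrite ?route_shift_succ; try (simpl; lia).
      intro f_eq. f_equal. apply f_inj; lia.
  - etransitivity; [exact (shift_proper (canonical_perm_circ f_can))|].
    cbn [perm_circ]. simpl (route _ 0). rewrite insert_0, ceq_comp_idr.
    erewrite perm_circ_ext; [reflexivity|].
    intros i i_lt. cbn beta. rewrite route_shift_succ. reflexivity.
Qed.

Lemma canonical_swap_top k : canonical (swap_top k).
Proof.
  apply canonical_endo.
  - split.
    + intros [|[|i]] i_lt; simpl; lia.
    + intros [|[|i]] [|[|j]] i_lt j_lt; simpl; lia.
  - cbn [perm_circ]. simpl (route _ 0). rewrite perm_circ_id, shift_id, ceq_comp_idl.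
    + simpl. rewrite !insert_0, shift_id, ceq_comp_idl, ceq_comp_idr. reflexivity.
    + intros i i_lt. apply Nat.sub_0_r.
Qed.

Lemma canonical_tens_id_l n m m' (g : circ m m') : canonical g -> canonical (c_id n [*] g).
Proof.
  intro g_can. induction n as [|n IH].
  - apply (canonical_ceq (ceq_lunit g)); [|exact g_can].
    intros i i_lt. simpl. rewrite Nat.sub_0_r. reflexivity.
  - apply canonical_ceq with (g := shift (c_id n [*] g)); [| |exact (canonical_shift IH)].
    + rewrite <- shift_tens, shift_id. reflexivity.
    + intros [|i] i_lt; [reflexivity|]. simpl. rewrite Nat.sub_0_r. cases_ltb.
Qed.

Lemma canonical_tens_id_r n n' m (f : circ n n') : canonical f -> canonical (f [*] c_id m).
Proof.
  intro f_can. destruct (proj1 f_can), (proj1 (proj2 f_can)) as [f_lt f_inj].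
  apply canonical_endo.
  - split.
    + intros i i_lt. simpl. cases_ltb. pose proof (f_lt i). lia.
    + intros i j i_lt j_lt. simpl. pose proof (f_lt i). pose proof (f_lt j). cases_ltb.
      intro f_eq. apply f_inj; lia.
  - etransitivity; [exact (ceq_tens (canonical_perm_circ f_can) (ceq_refl (c_id m)))|].
    rewrite perm_circ_tens by apply f_can.
    erewrite perm_circ_ext; [reflexivity|]. intros i i_lt. simpl. cases_ltb.
Qed.

Lemma canonical_tens n m n' m' (f : circ n n') (g : circ m m') :
  canonical f -> canonical g -> canonical (f [*] g).
Proof.
  intros f_can g_can. apply (canonical_ceq (tens_split f g)).
  - pose proof (proj1 (proj1 (proj2 f_can))) as f_lt. destruct (proj1 f_can).
    intros i i_lt. simpl. pose proof (f_lt i). cases_ltb.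
    f_equal. f_equal. lia.
  - apply canonical_comp; [apply canonical_tens_id_r | apply canonical_tens_id_l]; assumption.
Qed.

Lemma swap_cancel n m p (f g : circ p (n + m)) :
  f ;; c_swap n m ≅ g ;; c_swap n m -> f ≅ g.
Proof.
  intro fg. rewrite <- (ceq_comp_idr f), <- (ceq_comp_idr g), <- ceq_swapK.
  rewrite <- !ceq_comp_assoc, fg. reflexivity.
Qed.

Lemma swap_zero_r n (e : n + 0 = n) : c_swap n 0 ≅ c_idto e.
Proof.
  assert (e0 : n + 0 + 0 = n + 0) by lia.
  assert (swap_id0 : c_swap n 0 [*] c_id 0 ≅ c_idto e0).
  { apply swap_cancel. symmetry.
    pose proof (@hexagon_idto n 0 0 (eq_sym e0) eq_refl eq_refl) as hexagon0.
    etransitivity; [exact (ceq_comp (ceq_refl _) hexagon0)|]. simpl c_idto.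
    rewrite !ceq_comp_assoc, <- ceq_comp_assoc, c_idto_compK.
    rewrite !ceq_comp_idl, ceq_comp_idr, ceq_lunit. reflexivity. }
  rewrite <- (ceq_comp_idl (c_swap n 0)), <- (c_idto_compK (eq_sym e0) e0).
  rewrite ceq_comp_assoc, <- (tens_id0_idto (c_swap n 0) e0 e).
  rewrite swap_id0, <- ceq_comp_assoc, c_idto_compK. apply ceq_comp_idl.
Qed.

Lemma swap_zero_l n (e : n = n + 0) : c_swap 0 n ≅ c_idto e.
Proof.
  rewrite <- (ceq_comp_idr (c_swap 0 n)), <- (c_idto_compK (eq_sym e) e).
  rewrite <- (swap_zero_r (eq_sym e)), <- ceq_comp_assoc.
  rewrite (ceq_swapK 0 n). apply ceq_comp_idl.
Qed.

Lemma canonical_swap_one_l m : canonical (c_swap 1 m).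
Proof.
  induction m as [|m IH].
  - apply (canonical_ceq (@swap_zero_r 1 eq_refl)); [|apply canonical_idto].
    intros i i_lt. simpl. cases_ltb.
  - apply (canonical_ceq (swap_one_succ m)).
    + intros [|[|i]] i_lt; simpl; lia.
    + apply canonical_comp; [apply canonical_swap_top | exact (canonical_shift IH)].
Qed.

Lemma canonical_swap_one_r m : canonical (c_swap m 1).
Proof.
  apply (canonical_inverse (ceq_swapK 1 m)); [| |apply canonical_swap_one_l];
    intros i i_lt; cbn [route]; cases_ltb.
Qed.

Lemma canonical_swap n m : canonical (c_swap n m).
Proof.
  induction m as [|m IH].
  - apply (canonical_ceq (swap_zero_r (Nat.add_0_r n))); [|apply canonical_idto].
    intros i i_lt. rewrite route_idto. cbn [route]. cases_ltb.
  - assert (e : n + S m = n + 1 + m) by lia.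
    apply (canonical_ceq (@hexagon_idto n 1 m e eq_refl eq_refl)).
    + intros i i_lt. cbn [route c_idto]. rewrite route_idto. cases_ltb.
    + pose proof (canonical_shift IH).
      repeat apply canonical_comp; try apply canonical_idto; [|assumption].
      apply canonical_tens_id_r, canonical_swap_one_r.
Qed.

Lemma is_wiring_canonical n m (f : circ n m) : is_wiring f -> canonical f.
Proof.
  induction f; simpl; intro f_wiring; try contradiction.
  - exact (canonical_idto (eq_refl n)).
  - apply canonical_comp; tauto.
  - apply canonical_tens; tauto.
  - apply canonical_swap.
Qed.

Lemma wiring_perm n m (f : circ n m) : is_wiring f -> perm_on n (route f).
Proof. apply is_wiring_canonical. Qed.

Lemma wiring_perm_circ n (f : circ n n) : is_wiring f -> f ≅ perm_circ n (route f).
Proof. intro f_wiring. apply canonical_perm_circ, is_wiring_canonical, f_wiring. Qed.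

Theorem wiring_coherence n m (f g : circ n m) : is_wiring f -> is_wiring g ->
  (forall i, i < n -> route f i = route g i) -> f ≅ g.
Proof.
  intros f_wiring g_wiring route_eq.
  destruct (proj1 (is_wiring_canonical f_wiring)).
  rewrite (wiring_perm_circ f_wiring), (wiring_perm_circ g_wiring), (perm_circ_ext route_eq).
  reflexivity.
Qed.

Fixpoint dag n m (f : circ n m) : circ m n :=
  match f with
  | c_id n => c_id n
  | c_comp f g => dag g ;; dag f
  | c_tens f g => dag f [*] dag g
  | c_swap n m => c_swap m n
  | cnot => cnot
  | ket1 => bra1
  | bra1 => ket1
  end.

Lemma dagK n m (f : circ n m) : dag (dag f) = f.
Proof. induction f; simpl; congruence. Qed.

Lemma dag_idto n m (e : n = m) : dag (c_idto e) = c_idto (eq_sym e).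
Proof. destruct e. reflexivity. Qed.

Lemma is_wiring_dag n m (f : circ n m) : is_wiring f -> is_wiring (dag f).
Proof. induction f; simpl; tauto. Qed.

Lemma wiring_dagK n m (f : circ n m) : is_wiring f -> f ;; dag f ≅ c_id n.
Proof.
  induction f; simpl; intro f_wiring; try contradiction.
  - apply ceq_comp_idl.
  - rewrite ceq_comp_assoc, <- (ceq_comp_assoc f2), IHf2, ceq_comp_idl by tauto.
    apply IHf1, f_wiring.
  - rewrite <- ceq_tens_comp, IHf1, IHf2 by tauto. apply ceq_tens_id.
  - apply ceq_swapK.
Qed.

Lemma dag_wiringK n m (f : circ n m) : is_wiring f -> dag f ;; f ≅ c_id m.
Proof.
  intro f_wiring. pose proof (wiring_dagK (is_wiring_dag f_wiring)) as dag_eq.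
  rewrite dagK in dag_eq. exact dag_eq.
Qed.

Lemma wiring_epi n m p (f : circ n m) (g h : circ m p) : is_wiring f ->
  f ;; g ≅ f ;; h -> g ≅ h.
Proof.
  intros f_wiring fg_fh. rewrite <- (ceq_comp_idl g), <- (ceq_comp_idl h).
  rewrite <- (dag_wiringK f_wiring), !ceq_comp_assoc, fg_fh. reflexivity.
Qed.

Lemma route_lt n m (f : circ n m) i : is_wiring f -> i < n -> route f i < m.
Proof.
  intros f_wiring i_lt. destruct (proj1 (is_wiring_canonical f_wiring)).
  apply (wiring_perm f_wiring), i_lt.
Qed.

Lemma route_dag n m (f : circ n m) i : is_wiring f -> i < n -> route (dag f) (route f i) = i.
Proof.
  revert i; induction f; intros i f_wiring i_lt; simpl in f_wiring |- *; try contradiction.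
  - reflexivity.
  - rewrite IHf2, IHf1 by (try apply route_lt; tauto). reflexivity.
  - destruct f_wiring as [f1_wiring f2_wiring]. destruct (Nat.ltb_spec i n) as [i_lt_n|n_le_i].
    + pose proof (route_lt f1_wiring i_lt_n). rewrite IHf1 by assumption. cases_ltb.
    + assert (i_sub_lt : i - n < m) by lia.
      pose proof (route_lt f2_wiring i_sub_lt). cases_ltb.
      replace (n' + route f2 (i - n) - n') with (route f2 (i - n)) by lia.
      rewrite IHf2 by assumption. lia.
  - cases_ltb.
Qed.

(** * Cnot gates between arbitrary wires *)

Fixpoint distinct (n : nat) (l : list nat) : Prop :=
  match l with
  | [] => True
  | i :: l' => i < n /\ ~ In i l' /\ distinct n l'
  end.

Ltac distinct_lia := cbn [distinct In] in *; lia.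

Lemma distinct_lt n l i : distinct n l -> In i l -> i < n.
Proof. induction l as [|j l IH]; simpl; [tauto|]. intros [j_lt l_distinct] [<-|i_l]; tauto. Qed.

Lemma distinct_map n m q l : (forall i, In i l -> q i < m) ->
  (forall i j, In i l -> In j l -> q i = q j -> i = j) ->
  distinct n l -> distinct m (map q l).
Proof.
  induction l as [|i l IH]; simpl; [tauto|]. intros q_lt q_inj [i_lt [i_notin l_distinct]].
  split; [auto|]. split; [|apply IH; auto].
  intro qi_in. apply in_map_iff in qi_in. destruct qi_in as [j [q_eq j_in]].
  apply q_inj in q_eq; auto. subst j. contradiction.
Qed.

Lemma is_wiring_insert k j : is_wiring (insert k j).
Proof. revert j; induction k as [|k IH]; intros [|j]; simpl; auto. Qed.

Lemma route_insert_0 k j : j <= k -> route (insert k j) 0 = j.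
Proof.
  revert j; induction k as [|k IH]; intros [|j] jk; simpl; try lia.
  rewrite IH; lia.
Qed.

Lemma route_insert_succ k j x : j <= k -> x < k -> route (insert k j) (S x) = bump j x.
Proof.
  revert j x; induction k as [|k IH]; intros [|j] [|x] jk xk;
    try lia; try reflexivity.
  simpl. rewrite !Nat.sub_0_r, IH by lia.
  symmetry. apply bump_succ.
Qed.

(** [place n l] sends the first wires to the positions listed in [l]. *)
Fixpoint place (n : nat) (l : list nat) : circ n n :=
  match n with
  | 0 => c_id 0
  | S k =>
    match l with
    | [] => c_id (S k)
    | i :: l' => shift (place k (map (unbump i) l')) ;; insert k i
    end
  end.

Lemma is_wiring_place n l : is_wiring (place n l).
Proof.
  revert l; induction n as [|n IH]; intros [|i l]; simpl; auto using is_wiring_insert.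
Qed.

Lemma distinct_unbump n i l : distinct (S n) (i :: l) -> distinct n (map (unbump i) l).
Proof.
  intros [i_lt [i_notin l_distinct]].
  assert (l_ne : forall x, In x l -> x <> i) by (intros x x_in <-; contradiction).
  apply (@distinct_map (S n)); [| |exact l_distinct].
  - intros x x_in. pose proof (distinct_lt l_distinct x_in). pose proof (l_ne x x_in).
    unfold unbump. cases_ltb.
  - intros x y x_in y_in x_y.
    rewrite <- (bump_unbump (l_ne x x_in)), x_y. apply bump_unbump, l_ne, y_in.
Qed.

Lemma route_place n l k d : distinct n l -> k < length l ->
  route (place n l) k = nth k l d.
Proof.
  revert l k d; induction n as [|n IH]; intros [|i l] k d l_distinct k_lt;
    try (simpl in *; lia).
  pose proof (distinct_unbump l_distinct) as tail_distinct.
  destruct l_distinct as [i_lt [i_notin l_distinct]].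
  destruct k as [|k]; simpl; [apply route_insert_0; lia|]. simpl in k_lt.
  rewrite Nat.sub_0_r, (IH _ k (unbump i d) tail_distinct), map_nth by (rewrite length_map; lia).
  assert (nth_in : In (nth k l d) l) by (apply nth_In; lia).
  pose proof (distinct_lt l_distinct nth_in).
  assert (nth_ne : nth k l d <> i) by (intro nth_eq; rewrite nth_eq in nth_in; contradiction).
  rewrite route_insert_succ, bump_unbump; try assumption; try lia.
  unfold unbump. cases_ltb.
Qed.

Lemma route_place_pair n i j : distinct n [i; j] ->
  route (place n [i; j]) 0 = i /\ route (place n [i; j]) 1 = j.
Proof.
  intro ij_distinct.
  split; [apply (@route_place n [i; j] 0 0) | apply (@route_place n [i; j] 1 0)]; simpl; auto.
Qed.

Definition cnot_top n : circ n n :=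
  match n return circ n n with S (S k) => cnot [*] c_id k | n' => c_id n' end.

(** [gate n i j] is the cnot gate on [n] wires, with control [i] and target [j]. *)
Definition gate n i j : circ n n :=
  dag (place n [i; j]) ;; cnot_top n ;; place n [i; j].

Lemma wiring_cnot_top n (p : circ n n) : is_wiring p -> route p 0 = 0 -> route p 1 = 1 ->
  cnot_top n ;; p ≅ p ;; cnot_top n.
Proof.
  intros p_wiring p0 p1. destruct n as [|[|k]].
  1, 2: simpl; rewrite ceq_comp_idl, ceq_comp_idr; reflexivity.
  assert (p_eq : exists r, p ≅ c_id 2 [*] r).
  { eexists. rewrite <- shift_shift. etransitivity; [exact (wiring_perm_circ p_wiring)|].
    cbn [perm_circ]. rewrite p0, p1. simpl (unbump 0 1).
    rewrite !insert_0, !ceq_comp_idr. reflexivity. }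
  destruct p_eq as [r p_eq]. rewrite p_eq. apply (tens_interchange cnot r).
Qed.

Lemma gate_wiring n (p : circ n n) i j i' j' : is_wiring p -> distinct n [i; j] ->
  route p i = i' -> route p j = j' -> gate n i j ;; p ≅ p ;; gate n i' j'.
Proof.
  intros p_wiring ij_distinct <- <-.
  set (s := place n [i; j]). set (t := place n [route p i; route p j]).
  assert (s_wiring : is_wiring s) by apply is_wiring_place.
  assert (t_wiring : is_wiring t) by apply is_wiring_place.
  assert (t_distinct : distinct n [route p i; route p j]).
  { apply (@distinct_map n n (route p) [i; j]); [| |exact ij_distinct].
    - intros x x_in. apply (route_lt p_wiring), (distinct_lt ij_distinct x_in).
    - intros x y x_in y_in.
      apply (wiring_perm p_wiring); eauto using distinct_lt. }
  assert (fixes_top : forall k, k < 2 -> route (s ;; p ;; dag t) k = k).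
  { intros k k_lt. cbn [route].
    rewrite (route_place 0 ij_distinct) by exact k_lt.
    rewrite <- (map_nth (route p) [i; j] 0 k), <- (route_place _ t_distinct) by exact k_lt.
    apply route_dag; [exact t_wiring | distinct_lia]. }
  assert (slide : cnot_top n ;; (s ;; p ;; dag t) ≅ s ;; p ;; dag t ;; cnot_top n).
  { apply wiring_cnot_top; [|apply fixes_top; lia..].
    split; [split|]; auto using is_wiring_dag. }
  apply (wiring_epi s_wiring). unfold gate. fold s t.
  rewrite <- !ceq_comp_assoc, (wiring_dagK s_wiring), ceq_comp_idl, <- slide.
  rewrite !ceq_comp_assoc, (dag_wiringK t_wiring), ceq_comp_idr. reflexivity.
Qed.

Lemma gate_top k : gate (S (S k)) 0 1 ≅ cnot [*] c_id k.
Proof.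
  assert (place_id : place (S (S k)) [0; 1] ≅ c_id (S (S k))).
  { cbn [place map]. change (unbump 0 1) with 0.
    replace (place k []) with (c_id k) by (destruct k; reflexivity).
    rewrite !insert_0, shift_id, !ceq_comp_idr. apply shift_id. }
  unfold gate. rewrite <- (ceq_comp_idr (dag _)), <- place_id at 1.
  rewrite (dag_wiringK (is_wiring_place _ _)), place_id, ceq_comp_idl. apply ceq_comp_idr.
Qed.

Lemma place_gate n i j : distinct n [i; j] ->
  place n [i; j] ;; gate n i j ≅ gate n 0 1 ;; place n [i; j].
Proof.
  intro ij_distinct. symmetry. apply gate_wiring; [apply is_wiring_place|distinct_lia|..].
  - apply (route_place_pair ij_distinct).
  - apply (route_place_pair ij_distinct).
Qed.

Lemma gate_tens n m i j : distinct n [i; j] -> gate n i j [*] c_id m ≅ gate (n + m) i j.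
Proof.
  intro ij_distinct. destruct n as [|[|k]]; try distinct_lia.
  set (s := place (S (S k)) [i; j]).
  assert (s_wiring : is_wiring (s [*] c_id m)) by (split; [apply is_wiring_place | exact I]).
  apply (wiring_epi s_wiring). rewrite <- tens_comp_l. unfold s at 1.
  rewrite (place_gate ij_distinct), gate_top, tens_comp_l.
  rewrite (strict_assoc cnot (c_id k) (c_id m)), ceq_tens_id, <- gate_top.
  apply gate_wiring; [exact s_wiring | distinct_lia | |].
  - apply (route_place_pair ij_distinct).
  - apply (route_place_pair ij_distinct).
Qed.

Lemma shift_cnot_gate : shift cnot ≅ gate 3 1 2.
Proof.
  apply (@wiring_epi _ _ _ (c_swap 2 1) _ _ I).
  rewrite <- (@gate_wiring 3 (c_swap 2 1) 0 1) by (exact I || reflexivity || distinct_lia).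
  rewrite gate_top. symmetry. exact (ceq_swap_nat cnot (c_id 1)).
Qed.

Lemma shift_gate n i j : distinct n [i; j] -> shift (gate n i j) ≅ gate (S n) (S i) (S j).
Proof.
  intro ij_distinct. destruct n as [|[|k]]; try distinct_lia.
  set (s := place (S (S k)) [i; j]).
  assert (s_wiring : is_wiring (shift s)) by (split; [exact I | apply is_wiring_place]).
  assert (gate12 : shift (cnot [*] c_id k) ≅ gate (S (S (S k))) 1 2).
  { rewrite <- shift_tens, shift_cnot_gate. apply (@gate_tens 3 k 1 2). distinct_lia. }
  apply (wiring_epi s_wiring). rewrite <- shift_comp. unfold s at 1.
  rewrite (place_gate ij_distinct), gate_top, shift_comp, gate12.
  apply gate_wiring; [exact s_wiring | distinct_lia | |];
    rewrite route_shift_succ; f_equal; apply (route_place_pair ij_distinct).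
Qed.

Lemma cnot_cnot : cnot ;; cnot ≅ c_id 2.
Proof. exact (ceq_rel CNT2). Qed.

Lemma gate_gate n i j : distinct n [i; j] -> gate n i j ;; gate n i j ≅ c_id n.
Proof.
  intro ij_distinct. destruct n as [|[|k]]; try distinct_lia.
  apply (wiring_epi (is_wiring_place _ [i; j])).
  rewrite <- ceq_comp_assoc, place_gate, ceq_comp_assoc, place_gate by exact ij_distinct.
  rewrite <- ceq_comp_assoc, gate_top, <- (tens_comp_l k cnot cnot), cnot_cnot.
  rewrite (ceq_tens_id 2 k), ceq_comp_idl, ceq_comp_idr. reflexivity.
Qed.

Lemma dag_gate n i j : dag (gate n i j) ≅ gate n i j.
Proof.
  assert (dag_top : dag (cnot_top n) = cnot_top n) by (destruct n as [|[|n]]; reflexivity).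
  unfold gate. cbn [dag]. rewrite dagK, dag_top. symmetry. apply ceq_comp_assoc.
Qed.

Definition on_wires m k s (f : circ m m) : circ (m + k) (m + k) :=
  dag (place (m + k) s) ;; (f [*] c_id k) ;; place (m + k) s.

#[local] Instance on_wires_proper m k s :
  Proper (@ceq m m ==> @ceq (m + k) (m + k)) (@on_wires m k s).
Proof. intros f g fg. unfold on_wires. rewrite fg. reflexivity. Qed.

Lemma on_wires_comp m k s (f g : circ m m) :
  on_wires k s (f ;; g) ≅ on_wires k s f ;; on_wires k s g.
Proof.
  unfold on_wires. rewrite tens_comp_l, !ceq_comp_assoc, <- (ceq_comp_assoc (place _ s)).
  rewrite (wiring_dagK (is_wiring_place _ _)), ceq_comp_idl. reflexivity.
Qed.

Lemma on_wires_gate m k s i j : length s = m -> distinct (m + k) s -> distinct m [i; j] ->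
  on_wires k s (gate m i j) ≅ gate (m + k) (nth i s 0) (nth j s 0).
Proof.
  intros s_len s_distinct ij_distinct. unfold on_wires. rewrite (gate_tens k ij_distinct).
  rewrite ceq_comp_assoc, (@gate_wiring (m + k) (place (m + k) s) i j (nth i s 0) (nth j s 0)).
  - rewrite <- ceq_comp_assoc, (dag_wiringK (is_wiring_place _ _)). apply ceq_comp_idl.
  - apply is_wiring_place.
  - distinct_lia.
  - apply route_place; [exact s_distinct | distinct_lia].
  - apply route_place; [exact s_distinct | distinct_lia].
Qed.

Lemma cnot_gate : cnot ≅ gate 2 0 1.
Proof. rewrite gate_top. symmetry. exact (strict_runit cnot). Qed.

Lemma C2_21_gate : C2_21 ≅ gate 2 1 0.
Proof.
  unfold C2_21. rewrite cnot_gate, ceq_comp_assoc.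
  rewrite (@gate_wiring 2 sigma 0 1 1 0) by (exact I || reflexivity || distinct_lia).
  rewrite <- ceq_comp_assoc, (ceq_swapK 1 1). apply ceq_comp_idl.
Qed.

Lemma C3_12_gate : C3_12 ≅ gate 3 0 1.
Proof. symmetry. apply gate_top. Qed.

Lemma C3_21_gate : C3_21 ≅ gate 3 1 0.
Proof. unfold C3_21. rewrite C2_21_gate. apply (@gate_tens 2 1). distinct_lia. Qed.

Lemma C3_32_gate : C3_32 ≅ gate 3 2 1.
Proof. unfold C3_32. rewrite C2_21_gate. apply (@shift_gate 2 1 0). distinct_lia. Qed.

Lemma C3_13_gate : C3_13 ≅ gate 3 0 2.
Proof.
  change C3_13 with (swap_top 1 ;; shift cnot ;; swap_top 1).
  rewrite shift_cnot_gate, ceq_comp_assoc.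
  rewrite (@gate_wiring 3 (swap_top 1) 1 2 0 2)
    by (reflexivity || distinct_lia || split; exact I).
  rewrite <- ceq_comp_assoc, swap_topK. apply ceq_comp_idl.
Qed.

Lemma gate_control_comm n i j k : distinct n [i; j; k] ->
  gate n i j ;; gate n i k ≅ gate n i k ;; gate n i j.
Proof.
  intro ijk_distinct. destruct n as [|[|[|m]]]; try distinct_lia.
  assert (comm3 : gate 3 1 0 ;; gate 3 1 2 ≅ gate 3 1 2 ;; gate 3 1 0).
  { rewrite <- C3_21_gate, <- shift_cnot_gate. exact (ceq_rel CNT3). }
  apply (@on_wires_proper 3 m [j; i; k]) in comm3. rewrite !on_wires_comp in comm3.
  rewrite !on_wires_gate in comm3 by (reflexivity || distinct_lia). exact comm3.
Qed.

Lemma gate_target_comm n i j k : distinct n [i; j; k] ->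
  gate n i k ;; gate n j k ≅ gate n j k ;; gate n i k.
Proof.
  intro ijk_distinct. destruct n as [|[|[|m]]]; try distinct_lia.
  assert (comm3 : gate 3 0 1 ;; gate 3 2 1 ≅ gate 3 2 1 ;; gate 3 0 1).
  { rewrite <- C3_12_gate, <- C3_32_gate. exact (ceq_rel CNT5). }
  apply (@on_wires_proper 3 m [i; k; j]) in comm3. rewrite !on_wires_comp in comm3.
  rewrite !on_wires_gate in comm3 by (reflexivity || distinct_lia). exact comm3.
Qed.

Lemma gate_chain n i j k : distinct n [i; j; k] ->
  gate n i j ;; gate n j k ≅ gate n j k ;; gate n i k ;; gate n i j.
Proof.
  intro ijk_distinct. destruct n as [|[|[|m]]]; try distinct_lia.
  assert (chain3 : gate 3 0 1 ;; gate 3 1 2 ;; gate 3 0 1 ≅ gate 3 1 2 ;; gate 3 0 2).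
  { rewrite <- C3_12_gate, <- C3_13_gate, <- shift_cnot_gate. exact (ceq_rel CNT8). }
  apply (@on_wires_proper 3 m [i; j; k]) in chain3. rewrite !on_wires_comp in chain3.
  rewrite !on_wires_gate in chain3 by (reflexivity || distinct_lia). cbn [nth] in chain3.
  rewrite <- chain3, !ceq_comp_assoc, gate_gate, ceq_comp_idr by distinct_lia. reflexivity.
Qed.

Lemma gate_disjoint_comm n i j k l : distinct n [i; j; k; l] ->
  gate n i j ;; gate n k l ≅ gate n k l ;; gate n i j.
Proof.
  intro ijkl_distinct. destruct n as [|[|[|[|m]]]]; try distinct_lia.
  assert (comm4 : gate 4 0 1 ;; gate 4 2 3 ≅ gate 4 2 3 ;; gate 4 0 1).
  { rewrite gate_top, <- (@shift_gate 3 1 2), <- shift_cnot_gate, shift_shift by distinct_lia.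
    exact (tens_interchange cnot cnot). }
  apply (@on_wires_proper 4 m [i; j; k; l]) in comm4. rewrite !on_wires_comp in comm4.
  rewrite !on_wires_gate in comm4 by (reflexivity || distinct_lia). exact comm4.
Qed.

(* Copying commutes with [cnot] because of this identity: with [i], [k] the copied
  wires and [j], [l] their copies, the extra gate from [j] to [l] is controlled by a
  fresh |0>. *)
Lemma gate_square n i j k l : distinct n [i; j; k; l] ->
  gate n i j ;; gate n k l ;; gate n i k ;; gate n j l ≅
  gate n j l ;; (gate n i k ;; gate n i j ;; gate n k l).
Proof.
  intro ijkl_distinct.
  transitivity (gate n j l ;; gate n i l ;; gate n i j ;; gate n k l ;; gate n i k).
  - rewrite <- gate_chain by distinct_lia.
    rewrite (ceq_comp_assoc (gate n i j) (gate n j l)).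
    rewrite (@gate_target_comm n j k l), !ceq_comp_assoc by distinct_lia.
    rewrite (@gate_disjoint_comm n i k j l) by distinct_lia. reflexivity.
  - rewrite !ceq_comp_assoc. apply ceq_comp; [reflexivity|].
    rewrite <- !ceq_comp_assoc, (@gate_control_comm n i k j), (@gate_control_comm n i l j)
      by distinct_lia.
    rewrite !ceq_comp_assoc. apply ceq_comp; [reflexivity|].
    rewrite <- !ceq_comp_assoc, (@gate_target_comm n i k l), gate_chain by distinct_lia.
    reflexivity.
Qed.

(** * Invariance of the relations under the dagger *)

Lemma dag_C2_21 : dag C2_21 ≅ C2_21.
Proof. symmetry. exact (ceq_comp_assoc sigma cnot sigma). Qed.

Lemma dag_C3_21 : dag C3_21 ≅ C3_21.
Proof. exact (ceq_tens dag_C2_21 (ceq_refl (c_id 1))). Qed.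

Lemma dag_C3_32 : dag C3_32 ≅ C3_32.
Proof. exact (ceq_tens (ceq_refl (c_id 1)) dag_C2_21). Qed.

Lemma dag_C3_13 : dag C3_13 ≅ C3_13.
Proof. symmetry. exact (ceq_comp_assoc (sigma [*] c_id 1) C3_23 (sigma [*] c_id 1)). Qed.

Lemma dag_cnot_rel n m (f g : circ n m) : cnot_rel f g -> dag f ≅ dag g.
Proof.
  destruct 1; cbn [dag]; change (dag C2_12) with C2_12; change (dag C3_12) with C3_12;
    change (dag C3_23) with C3_23;
    rewrite ?dag_C2_21, ?dag_C3_21, ?dag_C3_32, ?dag_C3_13, <- ?ceq_comp_assoc.
  - exact (ceq_rel CNT1).
  - exact (ceq_rel CNT2).
  - symmetry. exact (ceq_rel CNT3).
  - exact (ceq_rel CNT4b).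
  - exact (ceq_rel CNT4a).
  - symmetry. exact (ceq_rel CNT5).
  - exact (ceq_rel CNT6).
  - exact (ceq_rel CNT7b).
  - exact (ceq_rel CNT7a).
  - rewrite (ceq_rel CNT8), C3_13_gate. change C3_23 with (shift cnot).
    rewrite shift_cnot_gate. symmetry. apply gate_target_comm. distinct_lia.
  - exact (ceq_rel CNT9).
Qed.

Lemma idto_transpose n m n' m' (f : circ n m) (g : circ n' m') (e : n = n') (e' : m = m') :
  f ;; c_idto e' ≅ c_idto e ;; g -> c_idto (eq_sym e) ;; f ≅ g ;; c_idto (eq_sym e').
Proof. destruct e, e'. simpl. rewrite !ceq_comp_idl, !ceq_comp_idr. auto. Qed.

Lemma dag_ceq n m (f g : circ n m) : f ≅ g -> dag f ≅ dag g.
Proof.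
  induction 1; simpl.
  - reflexivity.
  - symmetry. assumption.
  - etransitivity; eassumption.
  - apply ceq_comp; assumption.
  - apply ceq_tens; assumption.
  - apply ceq_comp_idr.
  - apply ceq_comp_idl.
  - symmetry. apply ceq_comp_assoc.
  - apply ceq_tens_id.
  - apply ceq_tens_comp.
  - unfold c_assoc. rewrite !dag_idto. apply idto_transpose, tens_assoc_idto.
  - apply ceq_lunit.
  - unfold c_runit. rewrite !dag_idto. apply idto_transpose, ceq_runit.
  - symmetry. apply ceq_swap_nat.
  - apply ceq_swapK.
  - unfold c_assoc. rewrite !dag_idto.
    apply wiring_coherence; simpl; auto using is_wiring_idto.
    intros i i_lt. rewrite !route_idto. cases_ltb.
  - apply dag_cnot_rel. assumption.
Qed.

#[local] Instance dag_proper n m : Proper (@ceq n m ==> @ceq m n) (@dag n m).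
Proof. intros f g. apply dag_ceq. Qed.

(** * Ancillary wires *)

Definition not1 : circ 1 1 := (ket1 [*] c_id 1) ;; cnot ;; (bra1 [*] c_id 1).
Definition ket0 : circ 0 1 := ket1 ;; not1.
Definition bra0 : circ 1 0 := dag ket0.

Lemma ket1_cnot : (ket1 [*] c_id 1) ;; cnot ≅ not1 ;; (ket1 [*] c_id 1).
Proof. exact (ceq_rel CNT4a). Qed.

Lemma cnot_bra1 : cnot ;; (bra1 [*] c_id 1) ≅ (bra1 [*] c_id 1) ;; not1.
Proof. unfold not1. rewrite <- !ceq_comp_assoc. exact (ceq_rel CNT4b). Qed.

Lemma not1_not1 : not1 ;; not1 ≅ c_id 1.
Proof.
  unfold not1 at 2. rewrite <- !ceq_comp_assoc, <- ket1_cnot.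
  rewrite (ceq_comp_assoc _ cnot cnot), cnot_cnot, ceq_comp_idr.
  rewrite <- (tens_comp_l 1 ket1 bra1), (ceq_rel CNT6). apply ceq_lunit.
Qed.

Lemma dag_not1 : dag not1 ≅ not1.
Proof. unfold not1. simpl. rewrite ceq_comp_assoc. reflexivity. Qed.

Lemma ket0_not1 : ket0 ;; not1 ≅ ket1.
Proof. unfold ket0. rewrite ceq_comp_assoc, not1_not1. apply ceq_comp_idr. Qed.

Lemma ket0_bra0 : ket0 ;; bra0 ≅ c_id 0.
Proof.
  unfold bra0, ket0 at 2. cbn [dag]. rewrite dag_not1, <- ceq_comp_assoc, ket0_not1.
  exact (ceq_rel CNT6).
Qed.

Lemma ket_natural l n m (k : circ 0 l) (f : circ n m) :
  f ;; (k [*] c_id m) ≅ (k [*] c_id n) ;; (c_id l [*] f).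
Proof. rewrite tens_interchange. apply ceq_comp; [symmetry; apply ceq_lunit | reflexivity]. Qed.

Lemma ket_swap l (k : circ 0 l) : (k [*] c_id 1) ;; c_swap l 1 ≅ c_id 1 [*] k.
Proof.
  rewrite ceq_swap_nat, (@swap_zero_l 1 eq_refl). apply ceq_comp_idl.
Qed.

Lemma ket0_cnot : (ket0 [*] c_id 1) ;; cnot ≅ ket0 [*] c_id 1.
Proof.
  assert (ket0_eq :
    (ket1 [*] ket1 [*] c_id 1) ;; C3_12 ;; (bra1 [*] c_id 2) ≅ ket0 [*] c_id 1).
  { unfold C3_12, C2_12. rewrite <- (tens_comp_l 1 (ket1 [*] ket1) cnot).
    rewrite <- (ceq_tens_id 1 1), <- (strict_assoc bra1 (c_id 1) (c_id 1)).
    rewrite <- (tens_comp_l 1 ((ket1 [*] ket1) ;; cnot) (bra1 [*] c_id 1)).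
    unfold ket0, not1. rewrite (tens_split_r ket1 ket1), (ceq_lunit ket1).
    rewrite !ceq_comp_assoc. reflexivity. }
  assert (cnot_slide : (bra1 [*] c_id 2) ;; cnot ≅ C3_23 ;; (bra1 [*] c_id 2)).
  { rewrite <- (ceq_lunit cnot). exact (tens_interchange bra1 cnot). }
  rewrite <- ket0_eq, (ceq_comp_assoc _ _ cnot), cnot_slide, <- ceq_comp_assoc.
  exact (ceq_rel CNT7a).
Qed.

Definition insert_zero n i : circ n (S n) := (ket0 [*] c_id n) ;; insert n i.

Lemma ket0_shift n m (f : circ n m) : f ;; (ket0 [*] c_id m) ≅ (ket0 [*] c_id n) ;; shift f.
Proof. apply (ket_natural ket0 f). Qed.

Lemma ket0_swap_top n : (ket0 [*] c_id (S n)) ;; swap_top n ≅ shift (ket0 [*] c_id n).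
Proof.
  unfold swap_top. rewrite <- shift_tens. unfold shift. rewrite <- ket_swap.
  rewrite tens_comp_l, (strict_assoc ket0 (c_id 1) (c_id n)), (ceq_tens_id 1 n).
  reflexivity.
Qed.

Lemma ket0_gate n b : b < n -> (ket0 [*] c_id n) ;; gate (S n) 0 (S b) ≅ ket0 [*] c_id n.
Proof.
  intro b_lt. destruct n as [|n]; [lia|].
  assert (target1 : (ket0 [*] c_id (S n)) ;; gate (S (S n)) 0 1 ≅ ket0 [*] c_id (S n)).
  { rewrite gate_top, <- (ceq_tens_id 1 n), <- (strict_assoc ket0 (c_id 1) (c_id n)).
    rewrite <- (tens_comp_l n (ket0 [*] c_id 1) cnot), ket0_cnot. reflexivity. }
  apply (wiring_epi (is_wiring_insert n b)).
  rewrite <- ceq_comp_assoc, ket0_shift, ceq_comp_assoc.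
  rewrite <- (@gate_wiring (S (S n)) (shift (insert n b)) 0 1).
  - rewrite <- ceq_comp_assoc, target1. symmetry. apply ket0_shift.
  - split; [exact I | apply is_wiring_insert].
  - distinct_lia.
  - reflexivity.
  - rewrite route_shift_succ, route_insert_0 by lia. reflexivity.
Qed.

Lemma gate_insert_zero n i a b : i <= n -> distinct n [a; b] ->
  gate n a b ;; insert_zero n i ≅ insert_zero n i ;; gate (S n) (bump i a) (bump i b).
Proof.
  intros i_le ab_distinct. unfold insert_zero.
  rewrite <- ceq_comp_assoc, ket0_shift, shift_gate, !ceq_comp_assoc by exact ab_distinct.
  rewrite (@gate_wiring (S n) (insert n i) (S a) (S b) (bump i a) (bump i b)).
  - reflexivity.
  - apply is_wiring_insert.
  - distinct_lia.
  - apply route_insert_succ; distinct_lia.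
  - apply route_insert_succ; distinct_lia.
Qed.

Lemma insert_zero_gate n i b : i <= n -> b < n ->
  insert_zero n i ;; gate (S n) i (bump i b) ≅ insert_zero n i.
Proof.
  intros i_le b_lt. unfold insert_zero.
  rewrite ceq_comp_assoc, <- (@gate_wiring (S n) (insert n i) 0 (S b)).
  - rewrite <- ceq_comp_assoc, (ket0_gate b_lt). reflexivity.
  - apply is_wiring_insert.
  - distinct_lia.
  - apply route_insert_0, i_le.
  - apply route_insert_succ; assumption.
Qed.

Lemma insert_zero_comm n i j : i <= j -> j <= n ->
  insert_zero n j ;; insert_zero (S n) i ≅ insert_zero n i ;; insert_zero (S n) (S j).
Proof.
  intros i_le j_le.
  assert (ket0_ket0_swap_top : (ket0 [*] c_id n) ;; (ket0 [*] c_id (S n)) ;; swap_top n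
    ≅ (ket0 [*] c_id n) ;; (ket0 [*] c_id (S n))).
  { rewrite ceq_comp_assoc, (ket0_swap_top n). symmetry. exact (ket0_shift (ket0 [*] c_id n)). }
  unfold insert_zero. rewrite !ceq_comp_assoc, <- !(ceq_comp_assoc (insert n _)), !ket0_shift.
  rewrite !ceq_comp_assoc, <- (insert_insert_lt (k := n) (b := i) (c := S j)) by lia.
  rewrite <- !ceq_comp_assoc, ket0_ket0_swap_top. reflexivity.
Qed.

Lemma shift_insert_zero n i : shift (insert_zero n i) ≅ insert_zero (S n) (S i).
Proof.
  unfold insert_zero. rewrite shift_comp, <- (ket0_swap_top n). apply ceq_comp_assoc.
Qed.

Lemma insert_zero_tens n m i : i <= n -> insert_zero n i [*] c_id m ≅ insert_zero (n + m) i.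
Proof.
  intro i_le. unfold insert_zero. rewrite (tens_comp_l m (ket0 [*] c_id n) (insert n i)).
  rewrite (strict_assoc ket0 (c_id n) (c_id m)), ceq_tens_id, insert_tens by exact i_le.
  reflexivity.
Qed.

(** * Copying one wire *)

Definition delta : circ 1 2 := (c_id 1 [*] ket0) ;; cnot.

Lemma last_ket0 : c_id 1 [*] ket0 ≅ insert_zero 1 1.
Proof.
  rewrite <- (shift_insert_zero 0 0). unfold insert_zero.
  rewrite (strict_runit ket0), ceq_comp_idr. reflexivity.
Qed.

Lemma delta_gate : delta ≅ insert_zero 1 1 ;; gate 2 0 1.
Proof. unfold delta. rewrite last_ket0, <- cnot_gate. reflexivity. Qed.

Lemma delta_tens m : delta [*] c_id m ≅ insert_zero (S m) 1 ;; gate (S (S m)) 0 1.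
Proof.
  rewrite delta_gate, (tens_comp_l m (insert_zero 1 1) (gate 2 0 1)).
  rewrite insert_zero_tens, gate_tens by (lia || distinct_lia). reflexivity.
Qed.

Lemma shift_delta : shift delta ≅ insert_zero 2 2 ;; gate 3 1 2.
Proof.
  rewrite delta_gate, shift_comp, shift_insert_zero, shift_gate by distinct_lia. reflexivity.
Qed.

Lemma delta_total : delta ;; dag delta ≅ c_id 1.
Proof.
  unfold delta. cbn [dag]. rewrite ceq_comp_assoc, <- (ceq_comp_assoc cnot), cnot_cnot.
  rewrite ceq_comp_idl, <- (tens_comp_r 1 ket0 bra0), ket0_bra0. apply (ceq_tens_id 1 0).
Qed.

Lemma delta_cocomm : delta ;; sigma ≅ delta.
Proof.
  assert (sigma_gates : sigma ≅ gate 2 0 1 ;; gate 2 1 0 ;; gate 2 0 1).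
  { rewrite <- C2_21_gate, <- cnot_gate. symmetry. exact (ceq_rel CNT1). }
  assert (control_zero : insert_zero 1 1 ;; gate 2 1 0 ≅ insert_zero 1 1)
    by (apply (@insert_zero_gate 1 1 0); lia).
  rewrite delta_gate, sigma_gates, ceq_comp_assoc, <- !(ceq_comp_assoc (gate 2 0 1)).
  rewrite gate_gate, ceq_comp_idl, <- ceq_comp_assoc, control_zero by distinct_lia.
  reflexivity.
Qed.

Lemma gate01_insert_zero1 : gate 2 0 1 ;; insert_zero 2 1 ≅ insert_zero 2 1 ;; gate 3 0 2.
Proof. apply (@gate_insert_zero 2 1 0 1); distinct_lia. Qed.

Lemma gate01_insert_zero2 : gate 2 0 1 ;; insert_zero 2 2 ≅ insert_zero 2 2 ;; gate 3 0 1.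
Proof. apply (@gate_insert_zero 2 2 0 1); distinct_lia. Qed.

Lemma insert_zero1_gate12 : insert_zero 2 1 ;; gate 3 1 2 ≅ insert_zero 2 1.
Proof. apply (@insert_zero_gate 2 1 1); lia. Qed.

Lemma delta_coassoc : delta ;; shift delta ≅ delta ;; (delta [*] c_id 1).
Proof.
  rewrite shift_delta, delta_tens, delta_gate, !ceq_comp_assoc.
  rewrite <- !(ceq_comp_assoc (gate 2 0 1)), gate01_insert_zero1, gate01_insert_zero2.
  rewrite (ceq_comp_assoc (insert_zero 2 2)), gate_chain by distinct_lia.
  rewrite <- !ceq_comp_assoc, <- (@insert_zero_comm 1 1 1) by lia.
  rewrite (ceq_comp_assoc (insert_zero 1 1) (insert_zero 2 1) (gate 3 1 2)).
  rewrite insert_zero1_gate12. reflexivity.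
Qed.

Lemma insert_zero_dag_insert_zero :
  insert_zero 2 1 ;; dag (insert_zero 2 2) ≅ dag (insert_zero 1 1) ;; insert_zero 1 1.
Proof.
  assert (ket0_bra0_comm : (ket0 [*] c_id 1) ;; (c_id 1 [*] bra0) ≅ bra0 ;; ket0).
  { rewrite <- (tens_split ket0 bra0), (tens_split_r ket0 bra0), ceq_lunit.
    rewrite (strict_runit ket0). reflexivity. }
  assert (insert_zero0 : insert_zero 1 0 ≅ ket0 [*] c_id 1) by apply ceq_comp_idr.
  rewrite <- (shift_insert_zero 1 0), <- (shift_insert_zero 1 1), <- last_ket0, insert_zero0.
  change (dag (shift (c_id 1 [*] ket0))) with (shift (c_id 1 [*] bra0)).
  change (dag (c_id 1 [*] ket0)) with (c_id 1 [*] bra0).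
  rewrite <- shift_comp, ket0_bra0_comm. exact (shift_comp bra0 ket0).
Qed.

Lemma delta_frob : (delta [*] c_id 1) ;; shift (dag delta) ≅ dag delta ;; delta.
Proof.
  assert (shift_dag_delta : shift (dag delta) ≅ gate 3 1 2 ;; dag (insert_zero 2 2)).
  { change (shift (dag delta)) with (dag (shift delta)). rewrite shift_delta. cbn [dag].
    rewrite dag_gate. reflexivity. }
  assert (dag_insert_zero2 :
    gate 3 0 1 ;; dag (insert_zero 2 2) ≅ dag (insert_zero 2 2) ;; gate 2 0 1).
  { rewrite <- (dag_gate 3), <- (dag_gate 2). symmetry. exact (dag_ceq gate01_insert_zero2). }
  rewrite delta_tens, shift_dag_delta, ceq_comp_assoc, <- (ceq_comp_assoc (gate 3 0 1)).
  rewrite gate_chain, <- !ceq_comp_assoc, insert_zero1_gate12 by distinct_lia.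
  rewrite <- gate01_insert_zero1.
  rewrite !ceq_comp_assoc, dag_insert_zero2, <- (ceq_comp_assoc (insert_zero 2 1)).
  rewrite insert_zero_dag_insert_zero, delta_gate. cbn [dag]. rewrite dag_gate, !ceq_comp_assoc.
  reflexivity.
Qed.

Lemma delta_bra1 : delta ;; (bra1 [*] c_id 1) ≅ bra1 ;; ket1.
Proof.
  unfold delta. rewrite ceq_comp_assoc, cnot_bra1, <- ceq_comp_assoc.
  rewrite <- (tens_split_r bra1 ket0), (tens_split bra1 ket0), (strict_runit bra1).
  rewrite (ceq_lunit ket0), ceq_comp_assoc, ket0_not1. reflexivity.
Qed.

Lemma ket1_delta : ket1 ;; delta ≅ ket1 [*] ket1.
Proof.
  assert (ket1_last : ket1 ;; (c_id 1 [*] ket0) ≅ ket0 ;; (ket1 [*] c_id 1)).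
  { rewrite (ket_natural ket1 ket0), (strict_runit ket1). reflexivity. }
  unfold delta. rewrite <- ceq_comp_assoc, ket1_last, ceq_comp_assoc, ket1_cnot.
  rewrite <- ceq_comp_assoc, ket0_not1, (tens_split_r ket1 ket1), ceq_lunit. reflexivity.
Qed.

Lemma delta_tens_delta :
  delta [*] delta ≅ insert_zero 2 1 ;; insert_zero 3 3 ;; gate 4 0 1 ;; gate 4 2 3.
Proof.
  rewrite tens_split, delta_tens, <- (shift_shift delta), shift_delta, shift_comp.
  rewrite shift_insert_zero, shift_gate by distinct_lia.
  rewrite !ceq_comp_assoc, <- (ceq_comp_assoc (gate 3 0 1)).
  rewrite (@gate_insert_zero 3 3 0 1) by distinct_lia. rewrite !ceq_comp_assoc. reflexivity.
Qed.

Lemma cnot_tens_cnot : cnot [*] cnot ≅ gate 4 0 1 ;; gate 4 2 3.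
Proof.
  rewrite tens_split, <- (gate_top 2), <- shift_shift, shift_cnot_gate.
  rewrite shift_gate by distinct_lia. reflexivity.
Qed.

Lemma insert_zero1_zero3_gate13 :
  insert_zero 2 1 ;; insert_zero 3 3 ;; gate 4 1 3 ≅ insert_zero 2 1 ;; insert_zero 3 3.
Proof.
  rewrite <- (@insert_zero_comm 2 1 2), ceq_comp_assoc by lia.
  rewrite (@insert_zero_gate 3 1 2) by lia. reflexivity.
Qed.

Definition swap_middle : circ 4 4 := shift (swap_top 1).

Lemma is_wiring_swap_middle : is_wiring swap_middle.
Proof. repeat split. Qed.

Lemma cnot_delta :
  cnot ;; ((delta [*] delta) ;; swap_middle) ≅
  (delta [*] delta) ;; swap_middle ;; (cnot [*] cnot).
Proof.
  assert (gates_slide :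
    swap_middle ;; (cnot [*] cnot) ≅ gate 4 0 2 ;; gate 4 1 3 ;; swap_middle).
  { rewrite cnot_tens_cnot, !ceq_comp_assoc.
    rewrite (gate_wiring (i := 1) (j := 3) (i' := 2) (j' := 3) is_wiring_swap_middle)
      by (reflexivity || distinct_lia).
    rewrite <- !ceq_comp_assoc.
    rewrite (gate_wiring (i := 0) (j := 2) (i' := 0) (j' := 1) is_wiring_swap_middle)
      by (reflexivity || distinct_lia).
    reflexivity. }
  rewrite (ceq_comp_assoc (delta [*] delta)), gates_slide, delta_tens_delta.
  rewrite <- !ceq_comp_assoc. apply ceq_comp; [|reflexivity].
  rewrite cnot_gate, gate01_insert_zero1, (ceq_comp_assoc (insert_zero 2 1)).
  rewrite (@gate_insert_zero 3 3 0 2), <- ceq_comp_assoc by distinct_lia.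
  change (bump 3 0) with 0. change (bump 3 2) with 2.
  set (zeros := insert_zero 2 1 ;; insert_zero 3 3). rewrite !(ceq_comp_assoc zeros).
  rewrite gate_square, <- (ceq_comp_assoc zeros (gate 4 1 3)) by distinct_lia.
  unfold zeros. rewrite insert_zero1_zero3_gate13, !ceq_comp_assoc. reflexivity.
Qed.

(** * Copying all wires *)

Definition exchange a a' b b' : circ (a + a' + (b + b')) (a + b + (a' + b')) :=
  c_assoc a a' (b + b')
  ;; (c_id a [*] c_idto (Nat.add_assoc a' b b'))
  ;; (c_id a [*] (c_swap a' b [*] c_id b'))
  ;; (c_id a [*] c_assoc b a' b')
  ;; c_idto (Nat.add_assoc a b (a' + b')).

Lemma is_wiring_exchange a a' b b' : is_wiring (exchange a a' b b').
Proof. repeat split; apply is_wiring_idto. Qed.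

Lemma route_exchange a a' b b' i : route (exchange a a' b b') i =
  if i <? a then i else if i <? a + a' then i + b
  else if i <? a + a' + b then i - a' else i.
Proof.
  unfold exchange, c_assoc. cbn [route]. rewrite !route_idto.
  cases_ltb; rewrite ?route_idto; cases_ltb.
Qed.

Ltac solve_is_wiring :=
  repeat lazymatch goal with
  | |- is_wiring (exchange _ _ _ _) => apply is_wiring_exchange
  | |- is_wiring (c_idto _) => apply is_wiring_idto
  | |- is_wiring (c_assoc _ _ _) => apply is_wiring_idto
  | |- is_wiring (_ ;; _) => split
  | |- is_wiring (_ [*] _) => split
  | |- is_wiring _ => exact I
  end.

(* Evaluates the innermost [route] first, which keeps its argument small.  The
  implicit indices may only be convertible to those of the lemmas, hence [replace]. *)
Ltac eval_route :=
  match goal with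
  | |- context [@route ?n ?m ?f ?i] =>
    lazymatch i with
    | context [route] => fail
    | context [_ <? _] => fail
    | _ =>
      let value := lazymatch f with
        | c_id _ => constr:(i)
        | c_idto _ => constr:(i)
        | c_comp ?g ?h => constr:(route h (route g i))
        | @c_tens ?n _ ?n' _ ?g ?h =>
          constr:(if i <? n then route g i else n' + route h (i - n))
        | c_swap ?n ?m => constr:(if i <? n then m + i else i - n)
        | exchange ?a ?a' ?b ?b' =>
          constr:(if i <? a then i else if i <? a + a' then i + b
            else if i <? a + a' + b then i - a' else i)
        end in
      replace (@route n m f i) with value
        by (symmetry; first [reflexivity | apply route_idto | apply route_exchange])
    end
  end.

Ltac solve_wiring :=
  apply wiring_coherence;
  [ solve_is_wiring | solve_is_wiring
  | intros; unfold c_assoc; repeat first [eval_route | case_ltb]; lia ].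

Lemma exchangeK a a' b b' : exchange a a' b b' ;; exchange a b a' b' ≅ c_id _.
Proof. solve_wiring. Qed.

Lemma dag_exchange a a' b b' : dag (exchange a a' b b') ≅ exchange a b a' b'.
Proof.
  rewrite <- (ceq_comp_idr (dag _)), <- (exchangeK a a' b b'), <- ceq_comp_assoc.
  rewrite (dag_wiringK (is_wiring_exchange a a' b b')). apply ceq_comp_idl.
Qed.

Lemma associ_natural n m p n' m' p' (f : circ n n') (g : circ m m') (h : circ p p') :
  (f [*] (g [*] h)) ;; c_idto (Nat.add_assoc n' m' p')
  ≅ c_idto (Nat.add_assoc n m p) ;; (f [*] g [*] h).
Proof.
  pose proof (idto_transpose (ceq_assoc f g h)) as assoc_eq.
  rewrite !eq_sym_involutive in assoc_eq. symmetry. exact assoc_eq.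
Qed.

Lemma tens_natural x x' y y' z z' (f : circ x x') (u : circ y y') (v : circ z z')
    (s : circ y z) (s' : circ y' z') : u ;; s' ≅ s ;; v ->
  (f [*] u) ;; (c_id x' [*] s') ≅ (c_id x [*] s) ;; (f [*] v).
Proof.
  intro us_sv. rewrite <- !ceq_tens_comp, us_sv, ceq_comp_idl, ceq_comp_idr. reflexivity.
Qed.

Lemma exchange_natural a a' b b' c c' d d'
    (f : circ a c) (f' : circ a' c') (g : circ b d) (g' : circ b' d') :
  (f [*] f' [*] (g [*] g')) ;; exchange c c' d d' ≅
  exchange a a' b b' ;; (f [*] g [*] (f' [*] g')).
Proof.
  assert (swap_natural : (f' [*] g [*] g') ;; (c_swap c' d [*] c_id d') ≅
                         (c_swap a' b [*] c_id b') ;; (g [*] f' [*] g')).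
  { rewrite <- !ceq_tens_comp, ceq_swap_nat, ceq_comp_idl, ceq_comp_idr. reflexivity. }
  unfold exchange. rewrite <- !ceq_comp_assoc, ceq_assoc.
  rewrite (ceq_comp_assoc (c_assoc _ _ _) _ (c_id c [*] _)).
  rewrite (tens_natural f (associ_natural f' g g')), <- ceq_comp_assoc.
  rewrite (ceq_comp_assoc _ _ (c_id c [*] (_ [*] _))), (tens_natural f swap_natural).
  rewrite <- ceq_comp_assoc, (ceq_comp_assoc _ _ (c_id c [*] c_assoc _ _ _)).
  rewrite (tens_natural f (ceq_assoc g f' g')), <- ceq_comp_assoc.
  rewrite (ceq_comp_assoc _ _ (c_idto _)), associ_natural, <- ceq_comp_assoc. reflexivity.
Qed.

Lemma exchange_conj a a' b b' c c' d d'
    (f : circ a c) (f' : circ a' c') (g : circ b d) (g' : circ b' d') :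
  f [*] f' [*] (g [*] g') ≅
  exchange a a' b b' ;; (f [*] g [*] (f' [*] g')) ;; exchange c d c' d'.
Proof.
  rewrite <- exchange_natural, ceq_comp_assoc, exchangeK. symmetry. apply ceq_comp_idr.
Qed.

Definition coassociative n (d : circ n (n + n)) :=
  d ;; (c_id n [*] d) ≅ d ;; (d [*] c_id n) ;; c_assoc n n n.

Definition semi_frobenius n (d : circ n (n + n)) :=
  (d [*] c_id n) ;; c_assoc n n n ;; (c_id n [*] dag d) ≅ dag d ;; d.

Definition tens_copy a b (d : circ a (a + a)) (e : circ b (b + b)) :
    circ (a + b) (a + b + (a + b)) :=
  (d [*] e) ;; exchange a a b b.

#[local] Instance tens_copy_proper a b :
  Proper (@ceq a (a + a) ==> @ceq b (b + b) ==> @ceq _ _) (@tens_copy a b).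
Proof. intros d d' dd' e e' ee'. unfold tens_copy. rewrite dd', ee'. reflexivity. Qed.

Section TensCopy.

Variables (a b : nat) (d : circ a (a + a)) (e : circ b (b + b)).

Lemma dag_tens_copy : dag (tens_copy d e) ≅ exchange a b a b ;; (dag d [*] dag e).
Proof. unfold tens_copy. cbn [dag]. rewrite dag_exchange. reflexivity. Qed.

Lemma tens_copy_total : d ;; dag d ≅ c_id a -> e ;; dag e ≅ c_id b ->
  tens_copy d e ;; dag (tens_copy d e) ≅ c_id (a + b).
Proof.
  intros d_total e_total. rewrite dag_tens_copy. unfold tens_copy.
  rewrite ceq_comp_assoc, <- (ceq_comp_assoc (exchange _ _ _ _)), exchangeK, ceq_comp_idl.
  rewrite <- ceq_tens_comp, d_total, e_total. apply ceq_tens_id.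
Qed.

Lemma tens_copy_cocomm : d ;; c_swap a a ≅ d -> e ;; c_swap b b ≅ e ->
  tens_copy d e ;; c_swap (a + b) (a + b) ≅ tens_copy d e.
Proof.
  intros d_cocomm e_cocomm.
  assert (exchange_swap : exchange a a b b ;; c_swap (a + b) (a + b) ≅
                          (c_swap a a [*] c_swap b b) ;; exchange a a b b) by solve_wiring.
  unfold tens_copy. rewrite ceq_comp_assoc, exchange_swap, <- ceq_comp_assoc.
  rewrite <- ceq_tens_comp, d_cocomm, e_cocomm. reflexivity.
Qed.

Lemma tens_copy_twice_r : tens_copy d e ;; (c_id (a + b) [*] tens_copy d e) ≅
  ((d ;; (c_id a [*] d)) [*] (e ;; (c_id b [*] e)))
  ;; (exchange a (a + a) b (b + b) ;; (c_id (a + b) [*] exchange a a b b)).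
Proof.
  unfold tens_copy. rewrite tens_comp_r, <- (ceq_tens_id a b) at 1.
  rewrite <- ceq_comp_assoc, (ceq_comp_assoc (d [*] e)), <- exchange_natural.
  rewrite <- ceq_comp_assoc, <- ceq_tens_comp, ceq_comp_assoc. reflexivity.
Qed.

Lemma tens_copy_twice_l : tens_copy d e ;; (tens_copy d e [*] c_id (a + b)) ≅
  ((d ;; (d [*] c_id a)) [*] (e ;; (e [*] c_id b)))
  ;; (exchange (a + a) a (b + b) b ;; (exchange a a b b [*] c_id (a + b))).
Proof.
  unfold tens_copy. rewrite tens_comp_l, <- (ceq_tens_id a b) at 1.
  rewrite <- ceq_comp_assoc, (ceq_comp_assoc (d [*] e)), <- exchange_natural.
  rewrite <- ceq_comp_assoc, <- ceq_tens_comp, ceq_comp_assoc. reflexivity.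
Qed.

Lemma tens_copy_coassoc :
  coassociative d -> coassociative e -> coassociative (tens_copy d e).
Proof.
  unfold coassociative. intros d_coassoc e_coassoc.
  assert (wires : (c_assoc a a a [*] c_assoc b b b)
      ;; (exchange a (a + a) b (b + b) ;; (c_id (a + b) [*] exchange a a b b)) ≅
    exchange (a + a) a (b + b) b ;; (exchange a a b b [*] c_id (a + b))
      ;; c_assoc (a + b) (a + b) (a + b)) by solve_wiring.
  rewrite tens_copy_twice_r, tens_copy_twice_l, d_coassoc, e_coassoc, ceq_tens_comp.
  rewrite ceq_comp_assoc, wires, <- ceq_comp_assoc. reflexivity.
Qed.

Lemma tens_copy_frob :
  semi_frobenius d -> semi_frobenius e -> semi_frobenius (tens_copy d e).
Proof.
  unfold semi_frobenius. intros d_frob e_frob.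
  assert (wires : exchange (a + a) a (b + b) b ;; (exchange a a b b [*] c_id (a + b))
      ;; c_assoc (a + b) (a + b) (a + b) ;; (c_id (a + b) [*] exchange a b a b)
      ;; exchange a b (a + a) (b + b) ≅ c_assoc a a a [*] c_assoc b b b) by solve_wiring.
  assert (copy_conj : (d [*] e) [*] c_id (a + b) ≅ exchange a b a b
      ;; (d [*] c_id a [*] (e [*] c_id b)) ;; exchange (a + a) a (b + b) b)
    by (rewrite <- ceq_tens_id; apply exchange_conj).
  assert (dag_conj : c_id (a + b) [*] (dag d [*] dag e) ≅ exchange a b (a + a) (b + b)
      ;; (c_id a [*] dag d [*] (c_id b [*] dag e)) ;; exchange a a b b)
    by (rewrite <- ceq_tens_id; apply exchange_conj).
  rewrite dag_tens_copy. unfold tens_copy.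
  rewrite tens_comp_l, tens_comp_r, copy_conj, dag_conj.
  transitivity (exchange a b a b
    ;; ((d [*] c_id a [*] (e [*] c_id b)) ;; (c_assoc a a a [*] c_assoc b b b)
        ;; (c_id a [*] dag d [*] (c_id b [*] dag e)))
    ;; exchange a a b b).
  - rewrite <- wires, !ceq_comp_assoc. reflexivity.
  - rewrite <- !ceq_tens_comp, d_frob, e_frob, ceq_tens_comp, !ceq_comp_assoc.
    reflexivity.
Qed.

End TensCopy.

Lemma tens_copy_assoc a b c (d : circ a (a + a)) (e : circ b (b + b)) (f : circ c (c + c)) :
  tens_copy (tens_copy d e) f ;; (c_assoc a b c [*] c_assoc a b c) ≅
  c_assoc a b c ;; tens_copy d (tens_copy e f).
Proof.
  assert (wires : (exchange a a b b [*] c_id (c + c)) ;; exchange (a + b) (a + b) c c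
      ;; (c_assoc a b c [*] c_assoc a b c) ≅
    c_assoc (a + a) (b + b) (c + c) ;; (c_id (a + a) [*] exchange b b c c)
      ;; exchange a a (b + c) (b + c)) by solve_wiring.
  unfold tens_copy.
  transitivity ((d [*] e [*] f) ;; ((exchange a a b b [*] c_id (c + c))
    ;; exchange (a + b) (a + b) c c ;; (c_assoc a b c [*] c_assoc a b c))).
  - rewrite <- !ceq_comp_assoc, <- ceq_tens_comp, ceq_comp_idr. reflexivity.
  - rewrite wires, <- !ceq_comp_assoc, ceq_assoc, (ceq_comp_assoc (c_assoc a b c)).
    rewrite <- ceq_tens_comp, ceq_comp_idr. reflexivity.
Qed.

Lemma c_assoc_1 n m : c_assoc 1 n m ≅ c_id (S (n + m)).
Proof. apply c_idto_id. Qed.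

Fixpoint copy (n : nat) : circ n (n + n) :=
  match n with
  | 0 => c_id 0
  | S k => tens_copy delta (copy k)
  end.

Lemma copy_uniform n m : copy (n + m) ≅ tens_copy (copy n) (copy m).
Proof.
  induction n as [|n IH].
  - assert (exchange_id : exchange 0 0 m m ≅ c_id (m + m)) by solve_wiring.
    unfold tens_copy. rewrite exchange_id, ceq_comp_idr. symmetry. apply ceq_lunit.
  - cbn [copy Nat.add]. rewrite IH.
    pose proof (tens_copy_assoc delta (copy n) (copy m)) as assoc_eq.
    rewrite c_assoc_1, ceq_tens_id, ceq_comp_idl, ceq_comp_idr in assoc_eq.
    symmetry. exact assoc_eq.
Qed.

Lemma copy_one : copy 1 ≅ delta.
Proof.
  assert (exchange_id : exchange 1 1 0 0 ≅ c_id 2) by solve_wiring.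
  cbn [copy]. unfold tens_copy. rewrite exchange_id, (strict_runit delta). apply ceq_comp_idr.
Qed.

Lemma copy_two : copy 2 ≅ (delta [*] delta) ;; swap_middle.
Proof.
  change (copy 2) with (tens_copy delta (copy 1)). rewrite copy_one.
  apply ceq_comp; [reflexivity|]. unfold swap_middle, shift, swap_top, sigma. solve_wiring.
Qed.

Lemma copy_total n : copy n ;; dag (copy n) ≅ c_id n.
Proof.
  induction n as [|n IH]; [apply ceq_comp_idl|]. exact (tens_copy_total delta_total IH).
Qed.

Lemma copy_cocomm n : copy n ;; c_swap n n ≅ copy n.
Proof.
  induction n as [|n IH]; [|exact (tens_copy_cocomm delta_cocomm IH)].
  rewrite (@swap_zero_l 0 eq_refl). apply ceq_comp_idl.
Qed.

Lemma copy_coassoc n : coassociative (copy n).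
Proof.
  induction n as [|n IH].
  - unfold coassociative. cbn [copy]. solve_wiring.
  - apply (tens_copy_coassoc (d := delta)); [|exact IH].
    unfold coassociative. rewrite c_assoc_1, ceq_comp_idr. exact delta_coassoc.
Qed.

Lemma copy_frob n : semi_frobenius (copy n).
Proof.
  induction n as [|n IH].
  - unfold semi_frobenius. cbn [copy dag]. solve_wiring.
  - apply (tens_copy_frob (d := delta)); [|exact IH].
    unfold semi_frobenius. rewrite c_assoc_1, ceq_comp_idr. exact delta_frob.
Qed.

Lemma copy_frob_r n :
  dag (copy n) ;; copy n ≅
  (c_id n [*] copy n) ;; dag (c_assoc n n n) ;; (dag (copy n) [*] c_id n).
Proof.
  pose proof (dag_ceq (copy_frob n)) as frob_dag. cbn [dag] in frob_dag.
  rewrite dagK, <- ceq_comp_assoc in frob_dag. symmetry. exact frob_dag.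
Qed.

Lemma copy_natural n m (f : circ n m) : f ;; copy m ≅ copy n ;; (f [*] f).
Proof.
  induction f.
  - rewrite ceq_comp_idl, ceq_tens_id, ceq_comp_idr. reflexivity.
  - rewrite ceq_comp_assoc, IHf2, <- ceq_comp_assoc, IHf1, ceq_comp_assoc, <- ceq_tens_comp.
    reflexivity.
  - rewrite !copy_uniform. unfold tens_copy.
    rewrite <- ceq_comp_assoc, <- ceq_tens_comp, IHf1, IHf2, ceq_tens_comp.
    rewrite !ceq_comp_assoc, exchange_natural. reflexivity.
  - rewrite !copy_uniform. unfold tens_copy.
    rewrite <- ceq_comp_assoc, <- ceq_swap_nat, !ceq_comp_assoc.
    apply ceq_comp; [reflexivity|]. solve_wiring.
  - rewrite copy_two. exact cnot_delta.
  - rewrite copy_one, ket1_delta. symmetry. apply ceq_comp_idl.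
  - rewrite copy_one.
    rewrite (tens_split bra1 bra1), <- ceq_comp_assoc, delta_bra1.
    rewrite ceq_comp_assoc, ceq_lunit, (ceq_rel CNT6). reflexivity.
Qed.

Lemma copy_graph_isometry n m (f : circ n m) : f ;; dag f ≅ c_id n ->
  copy n ;; (f [*] c_id n) ≅ f ;; copy m ;; (c_id m [*] dag f).
Proof.
  intro f_isometry.
  rewrite copy_natural, ceq_comp_assoc, <- ceq_tens_comp, f_isometry, ceq_comp_idr. reflexivity.
Qed.

Lemma copy_graph n m (f : circ n m) :
  copy n ;; (f [*] c_id n) ≅ f ;; copy m ;; (c_id m [*] dag f).
Proof.
  induction f.
  - apply copy_graph_isometry, ceq_comp_idl.
  - simpl dag. rewrite tens_comp_l, tens_comp_r, <- ceq_comp_assoc, IHf1.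
    rewrite (ceq_comp_assoc (f1 ;; copy m)), <- tens_interchange.
    rewrite (ceq_comp_assoc f1 (copy m)), <- (ceq_comp_assoc (copy m)), IHf2.
    rewrite !ceq_comp_assoc. reflexivity.
  - simpl dag. rewrite !copy_uniform, <- (ceq_tens_id n m), <- (ceq_tens_id n' m').
    unfold tens_copy. rewrite !ceq_comp_assoc, <- !exchange_natural, <- !ceq_comp_assoc.
    rewrite <- !ceq_tens_comp, IHf1, IHf2. reflexivity.
  - apply copy_graph_isometry, ceq_swapK.
  - apply copy_graph_isometry, cnot_cnot.
  - apply copy_graph_isometry. exact (ceq_rel CNT6).
  - rewrite copy_one, delta_bra1. simpl. rewrite ceq_comp_idr.
    apply ceq_comp; [reflexivity|]. symmetry. apply ceq_lunit.
Qed.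

Definition CNOT_involution : Involution CNOT.
Proof.
  refine {| dagger := fun A B : CNOT => @dag A B |}.
  - intros A B f. simpl. rewrite dagK. reflexivity.
  - reflexivity.
Defined.

Definition CNOT_inverse : InverseStructure CNOT :=
  @copying_inverse CNOT CNOT_involution copy copy_total copy_natural copy_cocomm copy_graph.

Theorem mainTheorem2 : is_discrete_inverse_category CNOT.
Proof.
  exists CNOT_inverse. split; [intros A B A' B' f g; reflexivity|].
  exists copy. split.
  - exact copy_total.
  - exact copy_natural.
  - exact copy_cocomm.
  - exact copy_coassoc.
  - exact copy_frob.
  - exact copy_frob_r.
  - exact copy_uniform.
Qed.
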